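(* Let $n\ge2$, $\widetilde{W}$ the affine Weyl group of type $\widetilde{C}_n$, and $w\in\widetilde{W}^S$. Then $w$ is palindromic if and only if $\pi(w)$ is a one-row shape $(j)$ with $0\le j\le 2n$ or a staircase shape $(k,k-1,k-2,\dots,1)$ with $1<k\le n$.
   Context: $\widetilde{W}$ has generators $s_0,\dots,s_n$ with $m(s_0,s_1)=4$, $m(s_i,s_{i+1})=3$ ($1\le i\le n-2$), $m(s_{n-1},s_n)=4$, others commuting; $S=\{s_1,\dots,s_n\}$, $\widetilde{W}^S$ the minimal length left coset representatives of $W_S$. Segments ($1\le j\le 2n$): $\sigma(j)=s_{j-1}\cdots s_1s_0$ for $j\le n+1$, $\sigma(j)=s_{2n-j+1}\cdots s_{n-1}s_ns_{n-1}\cdots s_1s_0$ for $n+1<j\le 2n$. For $w\in\widetilde{W}^S$, $w\neq\mathrm{id}$, write $ws_0=uv$ with $u\in\widetilde{W}^S$, $v\in W_S$, lengths adding; then $vs_0=\sigma(\lambda_1)$ for a unique $\lambda_1$ and $w=u\sigma(\lambda_1)$; repeating gives $w=\sigma(\lambda_f)\cdots\sigma(\lambda_1)$ and $\pi(w)=(\lambda_1,\dots,\lambda_f)$ ($\pi(\mathrm{id})=\emptyset=(0)$), a partition of $\ell(w)$. $P_w(t)=\sum_{v\in\widetilde{W}^S, v\le w}t^{\ell(v)}$ (Bruhat order); $w$ is palindromic if its coefficients satisfy $a_i=a_{\ell(w)-i}$ for all $i$. *)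

(* Defs.v *)
From HB Require Import structures.
From mathcomp Require Import all_boot all_order all_algebra.
From mathcomp Require Import boolp classical_sets cardinality fsbigop.

Set Implicit Arguments.
Unset Strict Implicit.
Unset Printing Implicit Defensive.

Import GRing.Theory.

Local Open Scope classical_set_scope.

(* The Coxeter group < s_i | s_i ^ 2 = 1, (s_i s_j) ^ (m i j) = 1 > as the
   quotient of the free monoid on I by the congruence generated by the
   relations. Since the generators are involutions this monoid presentation is
   the group presentation, and the inverse of a word is its reversal. The value
   m i j = 0 would encode m(s_i, s_j) = oo. *)
Inductive coxeq (I : Type) (m : I -> I -> nat) : seq I -> seq I -> Prop :=
| CoxInvol i : coxeq m [:: i; i] [::]
| CoxBraid i j : coxeq m (flatten (nseq (m i j) [:: i; j])) [::]
| CoxCat a b c d : coxeq m a b -> coxeq m c d -> coxeq m (a ++ c) (b ++ d)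
| CoxRefl a : coxeq m a a
| CoxSym a b : coxeq m a b -> coxeq m b a
| CoxTrans a b c : coxeq m a b -> coxeq m b c -> coxeq m a c.

Section CoxeterGroup.
Variables (I : finType) (m : I -> I -> nat).

Definition coxeqb : rel (seq I) := fun a b => `[< coxeq m a b >].

Lemma coxeqb_refl : reflexive coxeqb.
Proof. by move=> a; apply/asboolP; apply: CoxRefl. Qed.

Lemma coxeqb_sym : symmetric coxeqb.
Proof. by move=> a b; apply: asbool_equiv_eq; split; apply: CoxSym. Qed.

Lemma coxeqb_trans : transitive coxeqb.
Proof.
by move=> b a c /asboolP ab /asboolP bc; apply/asboolP; apply: CoxTrans ab bc.
Qed.

Canonical coxeqb_equiv := EquivRel coxeqb coxeqb_refl coxeqb_sym coxeqb_trans.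

Definition coxeter : Type := {eq_quot coxeqb}%qT.
HB.instance Definition _ := Choice.on coxeter.
HB.instance Definition _ := EqQuotient.on coxeter.

Definition cword (a : seq I) : coxeter := (\pi a)%qT.

Definition cgen (i : I) : coxeter := cword [:: i].

Lemma cwordP (a b : seq I) : cword a = cword b <-> coxeq m a b.
Proof.
by split=> [/eqmodP /asboolP //|ab]; apply/eqmodP; apply/asboolP.
Qed.

Lemma cword_surj (w : coxeter) : exists a, cword a = w.
Proof. by exists (repr w); rewrite /cword reprK. Qed.

Definition coxmul (x y : coxeter) : coxeter := cword (repr x ++ repr y).
Definition coxinv (x : coxeter) : coxeter := cword (rev (repr x)).

Lemma coxmulE (a b : seq I) : coxmul (cword a) (cword b) = cword (a ++ b).
Proof. by apply/cwordP; apply: CoxCat; apply/cwordP; rewrite /cword reprK. Qed.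

Lemma coxeq_revl (a : seq I) : coxeq m (rev a ++ a) [::].
Proof.
elim: a => [|i a IH]; first exact: CoxRefl.
rewrite rev_cons -cats1 -catA; apply: CoxTrans IH.
apply: CoxCat; first exact: CoxRefl.
by apply: (@CoxCat _ _ [:: i; i] [::]); [apply: CoxInvol | apply: CoxRefl].
Qed.

Lemma coxmulA : associative coxmul.
Proof.
move=> x y z; have [a <-] := cword_surj x; have [b <-] := cword_surj y.
by have [c <-] := cword_surj z; rewrite !coxmulE catA.
Qed.

Lemma coxmul1l : left_id (cword [::]) coxmul.
Proof. by move=> x; have [a <-] := cword_surj x; rewrite coxmulE. Qed.

Lemma coxmul1r : right_id (cword [::]) coxmul.
Proof. by move=> x; have [a <-] := cword_surj x; rewrite coxmulE cats0. Qed.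

Lemma coxmulVl : left_inverse (cword [::]) coxinv coxmul.
Proof.
move=> x; rewrite -{2}(reprK x) /coxinv -/(cword _) coxmulE.
by apply/cwordP; apply: coxeq_revl.
Qed.

Lemma coxmulVr : right_inverse (cword [::]) coxinv coxmul.
Proof.
move=> x; rewrite -{1}(reprK x) /coxinv -/(cword _) coxmulE.
by apply/cwordP; rewrite -{1}(revK (repr x)); apply: coxeq_revl.
Qed.

HB.instance Definition _ :=
  isGroup.Build coxeter coxmulA coxmul1l coxmul1r coxmulVl coxmulVr.

Local Open Scope group_scope.

Lemma ex_word_size (w : coxeter) :
  exists k, `[< exists2 a : seq I, size a = k & cword a = w >].
Proof.
by have [a aw] := cword_surj w; exists (size a); apply/asboolP; exists a.
Qed.

Definition clen (w : coxeter) : nat := ex_minn (ex_word_size w).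

Definition reflections : set coxeter :=
  [set t | exists x i, t = x * cgen i * x^-1].

Inductive bruhat : coxeter -> coxeter -> Prop :=
| BruhatRefl w : bruhat w w
| BruhatStep u t w : reflections t -> clen u < clen (u * t) ->
    bruhat (u * t) w -> bruhat u w.

Definition parabolic (J : pred I) : set coxeter :=
  [set w | exists2 a : seq I, all J a & cword a = w].

(* Elements of minimal length in their coset w W_J. *)
Definition minreps (J : pred I) : set coxeter :=
  [set w | forall v, parabolic J v -> clen w <= clen (w * v)].

Definition lower_minreps (J : pred I) (w : coxeter) : set coxeter :=
  [set v | minreps J v /\ bruhat v w].

(* Makes the finitely supported sum in poincare a genuine sum. *)
Lemma finite_lower_minreps (J : pred I) (w : coxeter) :
  finite_set (lower_minreps J w).
Proof.
have le_len u v : bruhat u v -> clen u <= clen v.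
  by elim=> // {}u t {}v _ lt_u _; apply: leq_trans (ltnW lt_u).
apply: (@sub_finite_set _ _
  ((fun a : (clen w).-bseq I => cword a) @` setT)); last first.
  exact/finite_image/finite_finset.
move=> v [_ /le_len le_vw]; move: le_vw; rewrite {1}/clen.
case: ex_minnP => k /asboolP [a <- av] _ le_aw.
by exists (Bseq le_aw).
Qed.

Local Open Scope ring_scope.

Definition poincare (J : pred I) (w : coxeter) : {poly int} :=
  \sum_(v \in lower_minreps J w) ('X^(clen v) : {poly int}).

(* For i > clen w both a_i and a_(clen w - i) vanish, so only i <= clen w
   matters; the bound avoids truncated subtraction. *)
Definition palindromic (J : pred I) (w : coxeter) : Prop :=
  forall i, (i <= clen w)%N ->
    (poincare J w)`_i = (poincare J w)`_(clen w - i).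

End CoxeterGroup.

(* Coxeter matrix of type C~_n, correct for n >= 2. *)
Definition affC_mx (n : nat) (i j : 'I_n.+1) : nat :=
  if i == j then 1
  else if (i.+1 == j) || (j.+1 == i) then
    if (minn i j == 0) || (maxn i j == n) then 4 else 3
  else 2.

Notation affC n := (coxeter (@affC_mx n)).

Definition affS (n : nat) : pred 'I_n.+1 := fun i => i != ord0.

Definition affC_s0 (n : nat) : affC n := cgen (@affC_mx n) ord0.

(* The indices of s_{j-1} ... s_1 s_0 for j <= n + 1, and of
   s_{2n-j+1} ... s_{n-1} s_n s_{n-1} ... s_1 s_0 for n + 1 < j <= 2n. *)
Definition segment_word (n j : nat) : seq nat :=
  if j <= n.+1 then rev (iota 0 j)
  else iota (n.*2 - j).+1 (j - n.+1) ++ rev (iota 0 n.+1).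

Definition segment (n j : nat) : affC n :=
  cword (@affC_mx n) [seq inord k | k <- segment_word n j].

Inductive segment_decomp (n : nat) : affC n -> seq nat -> Prop :=
| SegDecomp1 : segment_decomp (1%g : affC n) [::]
| SegDecompS (w u v : affC n) (j : nat) (lam : seq nat) :
    minreps (@affS n) w -> w <> 1%g ->
    minreps (@affS n) u -> parabolic (@affS n) v ->
    (w * affC_s0 n = u * v)%g ->
    clen (w * affC_s0 n)%g = clen u + clen v ->
    0 < j <= n.*2 -> (v * affC_s0 n)%g = segment n j ->
    segment_decomp u lam -> segment_decomp w (j :: lam).

(* The partition pi(w); [::] is the empty partition (0). Every w in W^S has
   exactly one segment decomposition, so the default is never used there. *)
Definition seg_part (n : nat) (w : affC n) : seq nat :=
  xget [::] [set lam | segment_decomp w lam].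

Definition one_row (j : nat) : seq nat := if j == 0 then [::] else [:: j].

Definition staircase (k : nat) : seq nat := rev (iota 1 k).

(* Main.v *)
Require Import Defs.
From mathcomp Require Import all_boot all_order all_algebra finmap.
From mathcomp Require Import boolp classical_sets cardinality fsbigop.
From mathcomp Require Import zify.

(** The cosets of [W_S] are identified with the lattice [Z^n]: [s_0] sends
    [x_1] to [1 - x_1], [s_i] exchanges [x_i] and [x_(i+1)], [s_n] negates [x_n],
    and [W_S] is the stabiliser of the origin. The length of the minimal
    representative of a coset is the number [len x] of reflection hyperplanes
    strictly separating the lattice point [x] from the fundamental alcove, and
    [s_i] lowers it exactly when the simple affine root [aroot i x] is negative.
    The segments [sigma(j)] are the points with a single nonzero coordinate
    [1] or [-1], the staircases are the points [(1,...,1,0,...,0)].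

    Only one element of [W^S] has length 1 and only one has length 2, so a
    palindromic [w] has at most one element of [W^S] below it in corank 1 and at
    most one in corank 2. A reflection that lowers [len] by one gives an element
    of [W^S] covered by [w]; inspecting the possible shapes of [x] produces two
    such elements in corank 1 or in corank 2, unless [x] is one of the points
    above. Conversely the ideal below [sigma(j)] is the chain of the [sigma(i)],
    [i <= j], and the ideal below the staircase [k] is [{0,1}^k], on which
    complementation exchanges corank and rank. *)

Set Implicit Arguments.
Unset Strict Implicit.
Unset Printing Implicit Defensive.

Import Order.TTheory GRing.Theory Num.Theory.

(** * Strong exchange *)

(** The group is known only by its presentation, so the exactness of the lattice model has to be
    derived from the relations. That the stabiliser of the origin is no larger than [W_S] is the
    main obstacle. It is settled by rewriting: descending words of the same point are compared
    through the braid relations ([down_coset]). Strong exchange comes from a parity that respects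
    the relations ([inv_parity]). Together they make minimal representatives and their lengths
    readable on lattice points. Bruhat order is never characterised on points. Elements below [w]
    are produced by chains of reflections that lower [len] by one; other elements are excluded by
    the subword property, applied to one well chosen word. For a segment this word has a single
    letter [s_0], at its right end, so its subwords lead to the origin or into the [W_S]-orbit of
    (1,0,...,0). For the staircase [k] it uses only letters below [k], which preserve the 0/1 points
    supported on the first [k] entries. *)

Section StrongExchange.
Variables (I : finType) (m : I -> I -> nat).
Local Open Scope group_scope.
Local Notation W := (coxeter m).
Local Notation word := (cword m).
Local Notation gen := (cgen m).

Lemma word_cat a b : word (a ++ b) = word a * word b.
Proof. exact/esym/coxmulE. Qed.

Lemma word_cons i a : word (i :: a) = gen i * word a.
Proof. exact: (word_cat [:: i]). Qed.

Lemma word_rev a : word (rev a) = (word a)^-1.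
Proof.
apply: (mulIg (word a)); rewrite mulVg -word_cat.
exact/cwordP/coxeq_revl.
Qed.

Lemma gen_mulgg i : gen i * gen i = 1.
Proof. by rewrite -word_cons; apply/cwordP/CoxInvol. Qed.

Lemma gen_inv i : (gen i)^-1 = gen i.
Proof. by apply: (mulgI (gen i)); rewrite mulgV gen_mulgg. Qed.

Lemma gen_mulK i : involutive (fun x : W => gen i * x).
Proof. by move=> x; rewrite mulgA gen_mulgg mul1g. Qed.

Lemma clen_word_le a : clen (word a) <= size a.
Proof.
rewrite /clen; case: ex_minnP => k _; apply.
by apply/asboolP; exists a.
Qed.

Lemma clen_word (w : W) : exists2 a, size a = clen w & word a = w.
Proof. by rewrite /clen; case: ex_minnP => k /asboolP[a ak aw] _; exists a. Qed.

(* The parity of the number of [k] such that deleting the [k]-th letter of [a]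
   amounts to multiplying [word a] by [t] on the left. *)
Fixpoint inv_parity (a : seq I) (t : W) : bool :=
  if a is i :: b then (t == gen i) (+) inv_parity b (gen i * t * gen i)
  else false.

(** The reflection attached to a letter of [b] gets conjugated by [word a] once [a] stands in front.
    This cocycle rule reduces invariance of the parity to the defining relations. *)
Lemma inv_parity_cat a b t :
  inv_parity (a ++ b) t =
  inv_parity a t (+) inv_parity b ((word a)^-1 * t * word a).
Proof.
elim: a t => [|i a IH] t /=; first by rewrite invg1 mul1g mulg1.
by rewrite IH word_cons invgM gen_inv -addbA !mulgA.
Qed.

Lemma word_nseq2 i j k :
  word (flatten (nseq k [:: i; j])) = (gen i * gen j) ^+ k.
Proof.
elim: k => [|k IH] //=; rewrite expgS -IH !word_cons.
by rewrite mulgA.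
Qed.

Lemma inv_parity_nseq2 i j k t :
  inv_parity (flatten (nseq k [:: i; j])) t =
  \big[addb/false]_(0 <= l < k.*2) (t == (gen i * gen j) ^+ l * gen i).
Proof.
elim: k t => [|k IH] t; first by rewrite big_geq.
rewrite doubleS big_nat_recl // big_nat_recl //= IH expg0 expg1 mul1g.
congr (_ (+) (_ (+) _)).
  rewrite -(inj_eq (mulgI (gen i))) -(inj_eq (mulIg (gen i))).
  by rewrite -!mulgA gen_mulgg mulg1 gen_mulK.
apply: eq_bigr => l _; set r := gen i * gen j.
have rj : r * gen j = gen i by rewrite -mulgA gen_mulgg mulg1.
have jir : gen j * gen i * r = 1 by rewrite -mulgA gen_mulK gen_mulgg.
have conjI : injective (fun x : W => gen j * (gen i * x * gen i) * gen j).
  by move=> x y /mulIg/mulgI/mulIg/mulgI.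
rewrite -[in RHS](inj_eq conjI); congr (_ == _).
clearbody r; rewrite (expgS r) (expgSr r) -!mulgA gen_mulK rj.
by rewrite 2!mulgA jir mul1g.
Qed.

(** The letters of the word (s_i s_j)^m give the reflections (s_i s_j)^l s_i for l < 2m. As (s_i
    s_j)^m = 1, the second half of this list repeats the first, so every reflection is counted an
    even number of times. *)
Lemma inv_parity_braid i j t :
  inv_parity (flatten (nseq (m i j) [:: i; j])) t = false.
Proof.
rewrite inv_parity_nseq2 -addnn (@big_cat_nat _ _ _ (m i j)) ?leq_addr //=.
rewrite -{2}[m i j]add0n big_addn addnK.
have r1 : (gen i * gen j) ^+ m i j = 1.
  by rewrite -word_nseq2; apply/cwordP/CoxBraid.
under [X in _ (+) X]eq_bigr => l _ do rewrite expgnDr r1 mulg1.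
exact: addbb.
Qed.

Lemma inv_parity_eq a b t :
  coxeq m a b -> inv_parity a t = inv_parity b t.
Proof.
move=> ab; elim: ab t => {a b} [i|i j|a b c d ab IHab _ IHcd|//|a b _ IH|
  a b c _ IHab _ IHbc] t /=.
- rewrite addbF -(inj_eq (mulgI (gen i))) -(inj_eq (mulIg (gen i))).
  by rewrite gen_mulgg mul1g addbb.
- exact: inv_parity_braid.
- by rewrite !inv_parity_cat IHab IHcd; move/cwordP: ab => ->.
- by rewrite IH.
- by rewrite IHab IHbc.
Qed.

Lemma inv_parity_delete a t : inv_parity a t ->
  exists b i c, a = b ++ i :: c /\ t * word a = word (b ++ c).
Proof.
elim: a t => //= i a IH t; have [-> _|_ /=] := eqVneq t (gen i).
  by exists [::], i, a; rewrite word_cons gen_mulK.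
case/IH=> b [j [c [-> tE]]]; exists (i :: b), j, c; split=> //=.
by rewrite !word_cons -tE -!mulgA !gen_mulK.
Qed.

(** The middle letter counts [t] once. Conjugating [gen i] by itself changes nothing, so the outer
    halves contribute as in [x ++ rev x], a word of 1, hence evenly. *)
Lemma inv_parity_reflection x i t : t = word (x ++ i :: rev x) ->
  inv_parity (x ++ i :: rev x) t.
Proof.
rewrite word_cat word_cons word_rev => tE.
have xtx : (word x)^-1 * t * word x = gen i by rewrite tE !mulgA mulVg mul1g mulgVK.
have := @inv_parity_eq (x ++ rev x) [::] t.
rewrite !inv_parity_cat /= xtx eqxx gen_mulgg mul1g /= addbN => -> //.
by apply/cwordP; rewrite word_cat word_rev mulgV.
Qed.

(** The weak inequality is enough because the contradiction writes [word a] with strictly fewer than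
    [clen (t * word a)] letters; [a] may be unreduced. *)
Lemma strong_exchange a t : reflections t -> clen (t * word a) <= clen (word a) ->
  exists b i c, a = b ++ i :: c /\ t * word a = word (b ++ c).
Proof.
case=> x [i tE] le_ta; apply: inv_parity_delete; apply/negPn/negP => Nat.
have [y yx] := cword_surj x.
have tE' : t = word (y ++ i :: rev y).
  by rewrite word_cat word_cons word_rev yx mulgA.
have [b bta bE] := clen_word (t * word a).
have tt : t * t = 1.
  by rewrite tE -!mulgA mulKg (mulgA (gen i)) gen_mulgg mul1g mulgV.
(* If [t] is counted evenly in [a], it is counted oddly in a shortest word [b] of [t * word a]: the
   palindromic word of [t] put in front of [a] adds an odd count. Deleting a letter of [b] then
   gives back [word a]. *)
have /inv_parity_delete [c [j [d [bcd tbE]]]] : inv_parity b t.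
  rewrite (@inv_parity_eq b ((y ++ i :: rev y) ++ a)); last first.
    by apply/cwordP; rewrite word_cat -tE'.
  rewrite inv_parity_cat inv_parity_reflection // -tE'.
  by rewrite mulVg mul1g (negPf Nat).
move: le_ta; rewrite -bta -[X in clen X](mul1g (word a)) -tt -mulgA -bE tbE.
move/leq_trans/(_ (clen_word_le _)).
by rewrite bcd !size_cat /= addnS ltnn.
Qed.

Lemma reflection_conj t x : reflections t -> reflections (x * t * x^-1 : W).
Proof.
by case=> y [i ->]; exists (x * y), i; rewrite invgM !mulgA.
Qed.

Lemma strong_exchange_r a t : reflections t ->
  clen (word a * t) <= clen (word a) ->
  exists b i c, a = b ++ i :: c /\ word a * t = word (b ++ c).
Proof.
move=> /(reflection_conj (word a)) rt.
by have := strong_exchange (a := a) rt; rewrite mulgVK; apply.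
Qed.

(** Each step of the chain deletes one letter by exchange. Since exchange accepts unreduced words,
    the word [a] of [w] can be chosen freely to suit the ideal under study. *)
Lemma bruhat_subword u w : bruhat u w -> forall a, word a = w ->
  exists2 b, subseq b a & word b = u.
Proof.
elim=> {u w} [w a aw|u t w rt lt_u _ IH a /IH [b ba bE]]; first by exists a.
have tt : t * t = 1.
  case: rt => x [i ->].
  by rewrite -!mulgA mulKg (mulgA (gen i)) gen_mulgg mul1g mulgV.
have := @strong_exchange_r b _ rt; rewrite bE -mulgA tt mulg1.
case/(_ (ltnW lt_u)) => c [i [d [bcd ->]]]; exists (c ++ d) => //.
apply: subseq_trans ba; rewrite bcd; apply: cat_subseq => //.
exact: subseq_cons.
Qed.

Lemma bruhat_trans u v w : bruhat (m := m) u v -> bruhat v w -> bruhat u w.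
Proof. by elim=> // {}u t {}v rt lt_u _ IH /IH; apply: BruhatStep. Qed.

Lemma cat_eq_cat_cons (T : Type) (c a b d : seq T) j :
  c ++ a = b ++ j :: d ->
  (exists e, c = b ++ j :: e /\ d = e ++ a) \/
  (exists e, b = c ++ e /\ a = e ++ j :: d).
Proof.
elim: c b => [|x c IH] [|y b] /=; try by move=> ->; right; exists [::].
- by move->; right; exists (y :: b).
- by case=> -> <-; left; exists c.
by case=> -> /IH [[e [-> ->]]|[e [-> ->]]]; [left|right]; exists e.
Qed.

Lemma clen_mul_gen (w : W) i : clen (w * gen i) <= (clen w).+1.
Proof.
have [a <- <-] := clen_word w; rewrite -[_ * _](word_cat a [:: i]).
by apply: leq_trans (clen_word_le _) _; rewrite size_cat addn1.
Qed.

Lemma clenM (u v : W) : clen (u * v) <= clen u + clen v.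
Proof.
have [a <- <-] := clen_word u; have [b <- <-] := clen_word v.
by rewrite -word_cat -size_cat clen_word_le.
Qed.

Lemma clen1 : clen (1 : W) = 0.
Proof. by apply/eqP; rewrite -leqn0; apply: (clen_word_le [::]). Qed.

Lemma clen_eq0 (w : W) : clen w = 0 -> w = 1.
Proof. by have [[|i a] // <- <-] := clen_word w. Qed.

Variable J : pred I.

Lemma parabolicM (u v : W) :
  parabolic J u -> parabolic J v -> parabolic J (u * v).
Proof.
case=> a aJ <- [b bJ <-]; exists (a ++ b); rewrite ?word_cat //.
by rewrite all_cat aJ.
Qed.

Lemma parabolicV (u : W) : parabolic J u -> parabolic J u^-1.
Proof. by case=> a aJ <-; exists (rev a); rewrite ?word_rev // all_rev. Qed.

Lemma parabolic1 : parabolic J (1 : W).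
Proof. by exists [::]. Qed.

(* A shortening of [w * v] would have to delete a letter of [w], which [minreps]
   forbids, or a letter of a shortest word of [v] in the letters of [J]. *)
Lemma minreps_clen_word (w : W) a : minreps J w -> all J a ->
  (forall b, all J b -> word b = word a -> size a <= size b) ->
  clen (w * word a) = clen w + size a.
Proof.
move=> wJ.
elim/last_ind: a => [_ _|a i IH]; first by rewrite mulg1 addn0.
rewrite all_rcons size_rcons -cats1 word_cat => /andP [iJ aJ] amin.
have {IH} IH : clen (w * word a) = clen w + size a.
  apply: IH => // b bJ bE; rewrite -ltnS.
  have := amin (rcons b i); rewrite all_rcons iJ bJ size_rcons -cats1.
  by apply=> //; rewrite word_cat bE.
apply/eqP; rewrite eqn_leq mulgA addnS -IH clen_mul_gen ltnNge.
have [c cw cE] := clen_word w; rewrite -cE -word_cat.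
apply/negP => le_len.
have ri : reflections (gen i) by exists 1, i; rewrite invg1 mul1g mulg1.
have [b [j [d [bcd bE]]]] := strong_exchange_r ri le_len.
case: (cat_eq_cat_cons bcd) => [[e [ce de]]|[e [be ae]]].
  have wE : w * (word a * gen i * (word a)^-1) = word (b ++ e).
    by rewrite !mulgA -cE -(word_cat c a) bE de catA word_cat mulgK.
  have := wJ (word a * gen i * (word a)^-1); rewrite wE.
  have aiJ : parabolic J (word a) by exists a.
  have giJ : parabolic J (gen i) by exists [:: i]; rewrite //= iJ.
  move=> /(_ (parabolicM (parabolicM aiJ giJ) (parabolicV aiJ))).
  move=> /leq_trans/(_ (clen_word_le _)).
  by rewrite -cw ce !size_cat /= addnS ltnn.
suff : size a < size (e ++ d) by rewrite ae !size_cat /= addnS ltnNge leqnSn.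
apply: amin.
  by move: aJ; rewrite ae !all_cat /= => /and3P [-> _ ->].
by apply: (mulgI (word c)); rewrite mulgA -!(word_cat c) bE catA -be.
Qed.

Lemma minreps_clenM (w v : W) :
  minreps J w -> parabolic J v -> clen (w * v) = clen w + clen v.
Proof.
move=> wJ [a0 a0J a0v].
have exS : exists k, `[< exists2 a, all J a /\ size a = k & word a = v >].
  by exists (size a0); apply/asboolP; exists a0.
case: (ex_minnP exS) => k /asboolP [a [aJ ak] av] kmin.
have amin b : all J b -> word b = word a -> size a <= size b.
  move=> bJ bE; rewrite ak; apply: kmin; apply/asboolP.
  by exists b => //; rewrite bE.
(* With [w = 1] the previous lemma says that a word of [v] shortest among those in [J] is shortest
   among all words of [v]. *)
have J1 : minreps J (1 : W) by move=> x _; rewrite clen1.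
rewrite -av (minreps_clen_word wJ) //.
by have := minreps_clen_word J1 aJ amin; rewrite mul1g clen1 => ->.
Qed.
End StrongExchange.

(** * Coefficients of the Poincaré polynomial *)

Section Coefficients.
Variables (I : finType) (m : I -> I -> nat) (J : pred I).
Local Notation W := (coxeter m).
Local Open Scope ring_scope.

Lemma coef_poincare (w : W) i : (poincare J w)`_i =
  (count (fun v : W => clen v == i) (fset_set (lower_minreps J w)))%:R.
Proof.
rewrite /poincare fsbig_finite; last exact: finite_lower_minreps.
rewrite /= coef_sum.
rewrite -sum1_count natr_sum [RHS]big_mkcond /=.
by apply: eq_bigr => v _; rewrite coefXn eq_sym; case: eqP.
Qed.

Lemma mem_lower (w v : W) :
  (v \in fset_set (lower_minreps J w)) = `[< lower_minreps J w v >].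
Proof. by rewrite in_fset_set ?inE //; apply: finite_lower_minreps. Qed.

Lemma coef_poincare_le1 (w : W) i :
  (forall u v : W, minreps J u -> minreps J v ->
    clen u = i -> clen v = i -> u = v) ->
  (poincare J w)`_i <= 1.
Proof.
move=> uniq_i; rewrite coef_poincare lern1 -size_filter leqNgt.
have := filter_uniq (fun v : W => clen v == i)
  (fset_uniq (fset_set (lower_minreps J w))).
set s := filter _ _ => us; apply/negP => s2.
have [u [v [t sE]]] : exists u v t, s = u :: v :: t.
  by case: s s2 {us} => [|u [|v t]] // _; exists u, v, t.
have inS x : x \in s -> minreps J x /\ clen x = i.
  by rewrite mem_filter mem_lower => /andP [/eqP xi /asboolP []].
have [uS ui] : minreps J u /\ clen u = i by apply: inS; rewrite sE mem_head.
have [vS vi] : minreps J v /\ clen v = i.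
  by apply: inS; rewrite sE !inE eqxx orbT.
by move: us; rewrite sE /= inE (uniq_i u v) ?eqxx.
Qed.

Lemma coef_poincare_ge2 (w u v : W) i :
  lower_minreps J w u -> lower_minreps J w v -> u <> v ->
  clen u = i -> clen v = i -> 2 <= (poincare J w)`_i.
Proof.
move=> uw vw uv ui vi; rewrite coef_poincare ler_nat -size_filter.
have uv' : uniq [:: u; v] by rewrite /= inE andbT; apply/eqP.
apply: (uniq_leq_size uv') => x; rewrite !inE mem_filter mem_lower.
by case/orP=> /eqP ->; [rewrite ui|rewrite vi]; rewrite eqxx; apply/asboolP.
Qed.

(** The involution [r] pairs the indices of elements of length [i] with those of length
    [clen w - i], so the two coefficients are the same sum reindexed. *)
Lemma palindromic_enum (T : finType) (F : T -> W) (r : T -> T) (w : W) :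
  (forall v, lower_minreps J w v <-> exists t, F t = v) ->
  injective F -> involutive r ->
  (forall t, (clen (F (r t)) + clen (F t))%N = clen w) -> palindromic J w.
Proof.
move=> lowerE Finj rK rlen.
have coefE i : (poincare J w)`_i = (\sum_(t : T) (clen (F t) == i)%N)%:R.
  rewrite coef_poincare -sum1_count natr_sum big_mkcond /=.
  rewrite (perm_big [seq F t | t <- index_enum T]) /=; last first.
    apply: uniq_perm => [||v].
    - exact: fset_uniq.
    - by rewrite map_inj_uniq // index_enum_uniq.
    rewrite mem_lower; apply/asboolP/mapP => [/lowerE [t <-]|[t _ ->]].
      by exists t; rewrite ?mem_index_enum.
    by apply/lowerE; exists t.
  by rewrite big_map natr_sum; apply: eq_bigr => t _; case: eqP.
move=> i iw; rewrite !coefE; congr (_ %:R).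
rewrite (reindex_inj (inv_inj rK)) /=; apply: eq_bigr => t _.
by have rt := rlen t; congr (nat_of_bool _); lia.
Qed.
End Coefficients.

(** * The lattice model *)

Lemma cat_nseq_cons (T : Type) k (a : T) s :
  nseq k a ++ a :: s = a :: nseq k a ++ s.
Proof. by elim: k => //= k ->. Qed.

Section Lattice.
Local Open Scope ring_scope.

(* [lin_act k] is the action of [s_(k+1)]; indices beyond the list act
   trivially. *)
Fixpoint lin_act (k : nat) (x : seq int) : seq int :=
  match k, x with
  | 0%N, [:: a] => [:: - a]
  | 0%N, a :: b :: s => b :: a :: s
  | k'.+1, a :: s => a :: lin_act k' s
  | _, _ => x
  end.

Definition act (i : nat) (x : seq int) : seq int :=
  if i is k.+1 then lin_act k x
  else if x is a :: s then (1 - a) :: s else x.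

Fixpoint lin_root (k : nat) (x : seq int) : int :=
  match k, x with
  | 0%N, [:: a] => a
  | 0%N, a :: b :: _ => a - b
  | k'.+1, _ :: s => lin_root k' s
  | _, _ => 0
  end.

(** Descents depend only on the sign of a root, so its scale is free: [s_n] receives x_n rather than
    2x_n. Both double bonds of the diagram then obey the same rule [double_pair i j] with
    [i < j]. *)
Definition aroot (i : nat) (x : seq int) : int :=
  if i is k.+1 then lin_root k x else if x is a :: _ then 1 - a *+ 2 else 0.

(* The number of integers strictly between [d] and the open interval [(0, 1)],
   endpoints of the interval included. *)
Definition crossings (d : int) : int := if 0 < d then d - 1 else - d.

Definition pair_len (a b : int) : int := crossings (a - b) + crossings (a + b).

Definition row_len (a : int) (s : seq int) : int := \sum_(b <- s) pair_len a b.

(** The walls are 2x_i = k and x_i ± x_j = k with k an integer. On the fundamental alcove 1/2 > x_1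
    > ... > x_n > 0 the forms 2x_i, x_i - x_j and x_i + x_j, for i < j, all take values in (0, 1),
    so the one function [crossings] serves every family of parallel walls. *)
Fixpoint len (x : seq int) : int :=
  if x is a :: s then crossings (a *+ 2) + row_len a s + len s else 0.

Lemma size_lin_act k x : size (lin_act k x) = size x.
Proof. by elim: k x => [|k IH] [|a [|b s]] //=; rewrite IH. Qed.

Lemma size_act i x : size (act i x) = size x.
Proof. by case: i => [|k]; [case: x | rewrite /= size_lin_act]. Qed.

Lemma lin_actK k : involutive (lin_act k).
Proof.
elim: k => [|k IH] [|a s] //=; last by rewrite IH.
by case: s => //=; rewrite opprK.
Qed.

Lemma actK i : involutive (act i).
Proof.
case: i => [|k]; last exact: lin_actK.
by case=> //= a s; rewrite opprB addrC subrK.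
Qed.

Lemma crossings_ge0 d : 0 <= crossings d.
Proof. by rewrite /crossings; case: ifP; lia. Qed.

Lemma len_ge0 x : 0 <= len x.
Proof.
elim: x => //= a s IH; apply: addr_ge0 => //; apply: addr_ge0.
  exact: crossings_ge0.
by apply: sumr_ge0 => b _; rewrite /pair_len addr_ge0 ?crossings_ge0.
Qed.

Lemma pair_len_opp a b : pair_len a (- b) = pair_len a b.
Proof. by rewrite /pair_len opprK addrC. Qed.

(** [crossings] is symmetric under d -> 1 - d, and a -> 1 - a turns a - b into 1 - (a + b) and a + b
    into 1 - (a - b): the two terms are exchanged. *)
Lemma pair_len_flip a b : pair_len (1 - a) b = pair_len a b.
Proof. by rewrite /pair_len /crossings; do 4! case: ifP; lia. Qed.

Lemma row_len_flip a s : row_len (1 - a) s = row_len a s.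
Proof. by apply: eq_bigr => b _; apply: pair_len_flip. Qed.

Lemma row_len_act a k s : row_len a (lin_act k s) = row_len a s.
Proof.
elim: k s => [|k IH] [|b [|c s]] //=.
- by rewrite /row_len !big_seq1 pair_len_opp.
- by rewrite /row_len !big_cons addrCA.
- by rewrite /row_len !big_cons -!/(row_len _ _) IH.
by rewrite /row_len !big_cons -!/(row_len _ _) IH /row_len big_cons.
Qed.

Lemma lin_actP k x : (k < size x)%N ->
  (0 < lin_root k x -> len (lin_act k x) = len x + 1) /\
  (lin_root k x = 0 -> lin_act k x = x).
Proof.
elim: k x => [|k IH] [|a s] //=; last first.
  move/IH => [IH1 IH2]; split=> [/IH1 E|/IH2 -> //].
  by rewrite row_len_act E; lia.
case: s => [|b s] /=.
- rewrite /row_len !big_nil => _; split; rewrite /crossings; last by move=> ->.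
  by do 2! case: ifP; lia.
- move=> _; rewrite /row_len !big_cons -!/(row_len _ _); split; last first.
    by move=> ab; have -> : a = b by lia.
  move=> ab; suff : pair_len b a = pair_len a b + 1 by lia.
  by rewrite /pair_len addrC [b + a]addrC /crossings; do 3! case: ifP; lia.
Qed.

Lemma lin_root_act k x : (k < size x)%N ->
  lin_root k (lin_act k x) = - lin_root k x.
Proof.
elim: k x => [|k IH] [|a s] //=; last exact: IH.
by case: s => //= b s _; lia.
Qed.

Lemma aroot_act i x : (0 < size x)%N -> (i <= size x)%N ->
  aroot i (act i x) = - aroot i x.
Proof.
case: i => [|k] //=; last by move=> _; apply: lin_root_act.
by case: x => //= a s; lia.
Qed.

Lemma act_up i x : (0 < size x)%N -> (i <= size x)%N -> 0 < aroot i x ->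
  len (act i x) = len x + 1.
Proof.
case: i => [|k] /=; last by move=> _ /lin_actP [].
case: x => //= a s _ _ a0; rewrite row_len_flip.
by rewrite /crossings; do 2! case: ifP; lia.
Qed.

Lemma act_fix i x : (0 < size x)%N -> (i <= size x)%N -> aroot i x = 0 ->
  act i x = x.
Proof.
case: i => [|k] /=; last by move=> _ /lin_actP [].
by case: x => //= a s; lia.
Qed.

Lemma act_down i x : (0 < size x)%N -> (i <= size x)%N -> aroot i x < 0 ->
  len x = len (act i x) + 1.
Proof.
move=> x0 ix rx; rewrite -{1}(actK i x) act_up ?size_act //.
by rewrite aroot_act //; lia.
Qed.

Lemma lin_act_far k l x : (k.+1 < l)%N -> (l < size x)%N ->
  [/\ lin_act k (lin_act l x) = lin_act l (lin_act k x),
      lin_root k (lin_act l x) = lin_root k x &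
      lin_root l (lin_act k x) = lin_root l x].
Proof.
elim: k l x => [|k IH] [|l] [|a s] //= kl ls.
  by case: l s kl ls => [|l] [|b s].
by have [-> -> ->] := IH l s kl ls.
Qed.

Lemma lin_act_near k x : (k.+2 < size x)%N ->
  [/\ lin_act k (lin_act k.+1 (lin_act k x)) =
      lin_act k.+1 (lin_act k (lin_act k.+1 x)),
      lin_root k (lin_act k.+1 x) = lin_root k x + lin_root k.+1 x &
      lin_root k.+1 (lin_act k x) = lin_root k.+1 x + lin_root k x].
Proof.
elim: k x => [|k IH] [|a s] // ls.
  by case: s ls => [|b [|c s]] //= _; split=> //; lia.
by have [E1 E2 E3] := IH s ls; split=> //; apply: (congr1 (cons a) E1).
Qed.

Lemma lin_act_last k x : size x = k.+2 ->
  [/\ lin_act k (lin_act k.+1 (lin_act k (lin_act k.+1 x))) =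
      lin_act k.+1 (lin_act k (lin_act k.+1 (lin_act k x))),
      lin_root k (lin_act k.+1 x) = lin_root k x + lin_root k.+1 x *+ 2 &
      lin_root k.+1 (lin_act k x) = lin_root k.+1 x + lin_root k x].
Proof.
elim: k x => [|k IH] [|a s] // [ls].
  by case: s ls => [|b [|c s]] //= _; split=> //; lia.
by have [E1 E2 E3] := IH s ls; split=> //; apply: (congr1 (cons a) E1).
Qed.

Lemma act_far i j x : (i.+1 < j)%N -> (j <= size x)%N ->
  [/\ act i (act j x) = act j (act i x),
      aroot i (act j x) = aroot i x & aroot j (act i x) = aroot j x].
Proof.
case: i j => [|k] [|l] // kl lx; last exact: lin_act_far.
by case: l x kl lx => [|l] [|a s].
Qed.

Lemma act_near i x : (0 < i)%N -> (i.+1 < size x)%N ->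
  [/\ act i (act i.+1 (act i x)) = act i.+1 (act i (act i.+1 x)),
      aroot i (act i.+1 x) = aroot i x + aroot i.+1 x &
      aroot i.+1 (act i x) = aroot i.+1 x + aroot i x].
Proof. by case: i => [|k] // _; apply: lin_act_near. Qed.

Lemma act_last i x : (0 < i)%N -> size x = i.+1 ->
  [/\ act i (act i.+1 (act i (act i.+1 x))) =
      act i.+1 (act i (act i.+1 (act i x))),
      aroot i (act i.+1 x) = aroot i x + aroot i.+1 x *+ 2 &
      aroot i.+1 (act i x) = aroot i.+1 x + aroot i x].
Proof. by case: i => [|k] // _; apply: lin_act_last. Qed.

Lemma act_first x : (1 < size x)%N ->
  [/\ act 0 (act 1 (act 0 (act 1 x))) = act 1 (act 0 (act 1 (act 0 x))),
      aroot 1 (act 0 x) = aroot 1 x + aroot 0 x &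
      aroot 0 (act 1 x) = aroot 0 x + aroot 1 x *+ 2].
Proof. by case: x => [|a [|b s]] //= _; split=> //; lia. Qed.

Lemma lin_root_ge0 x : (forall k, (k < size x)%N -> 0 <= lin_root k x) ->
  {in x, forall b, 0 <= b <= head 0 x}.
Proof.
elim: x => //= a s IH rs b.
have /IH {}IH : forall k, (k < size s)%N -> 0 <= lin_root k s.
  by move=> k; apply: (rs k.+1).
have := rs 0%N isT; rewrite inE; case: s IH {rs} => [|c s] /=.
  by move=> _ a0 /predU1P [->|//]; lia.
move=> IH ac /predU1P [->|/IH]; last lia.
by have := IH c (mem_head _ _); lia.
Qed.

(** A point without descents lies in the closed alcove, so its entries decrease from at most 1/2 to
    at least 0; integrality leaves only the origin. *)
Lemma aroot_ge0 x : (0 < size x)%N ->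
  (forall i, (i <= size x)%N -> 0 <= aroot i x) -> x = nseq (size x) 0.
Proof.
move=> x0 rx; apply/all_pred1P/allP => b bx /=.
have := @lin_root_ge0 x (fun k => rx k.+1) b bx.
by move: (rx 0%N isT); case: (x) => /= [|a s]; lia.
Qed.

Lemma lin_act_cat k s t : lin_act (size s + k) (s ++ t) = s ++ lin_act k t.
Proof. by elim: s => //= a s ->. Qed.

Lemma lin_root_cat k s t : lin_root (size s + k) (s ++ t) = lin_root k t.
Proof. by elim: s. Qed.

Lemma act_swap i s a b t : i = (size s).+1 ->
  act i (s ++ a :: b :: t) = s ++ b :: a :: t.
Proof. by move->; rewrite /= -[size s]addn0 lin_act_cat. Qed.

Lemma aroot_swap i s a b t : i = (size s).+1 ->
  aroot i (s ++ a :: b :: t) = a - b.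
Proof. by move->; rewrite /= -[size s]addn0 lin_root_cat. Qed.

Lemma act_opp i s a : i = (size s).+1 -> act i (s ++ [:: a]) = s ++ [:: - a].
Proof. by move->; rewrite /= -[size s]addn0 lin_act_cat. Qed.

Lemma aroot_opp i s a : i = (size s).+1 -> aroot i (s ++ [:: a]) = a.
Proof. by move->; rewrite /= -[size s]addn0 lin_root_cat. Qed.

Lemma lin_root_nseq0 k q : lin_root k (nseq q 0) = 0.
Proof. by elim: k q => [|k IH] [|q] //=; case: q. Qed.

(** An invariant of [W_S], which acts by signed permutations. Its value 1 singles out the orbit of
    (1,0,...,0), which consists of the points of the nontrivial segments. *)
Definition abs_sum (x : seq int) : int := \sum_(b <- x) `|b|.

Lemma abs_sum_act k x : abs_sum (lin_act k x) = abs_sum x.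
Proof.
rewrite /abs_sum; elim: k x => [|k IH] [|a s] //=; last by rewrite !big_cons IH.
case: s => [|b s]; first by rewrite !big_seq1 normrN.
by rewrite !big_cons addrCA.
Qed.

Lemma abs_sum_ge0 x : 0 <= abs_sum x.
Proof. exact: sumr_ge0. Qed.

Lemma abs_sum0 x : abs_sum x = 0 -> x = nseq (size x) 0.
Proof.
elim: x => //= a s IH; rewrite /abs_sum big_cons -/(abs_sum s) => E.
by have := abs_sum_ge0 s => s0; rewrite {1}IH; [congr (_ :: _)|]; lia.
Qed.

Lemma abs_sum1 x : abs_sum x = 1 -> exists p c q,
  x = nseq p 0 ++ c :: nseq q 0 /\ (c = 1 \/ c = -1).
Proof.
elim: x => [|a s IH]; first by rewrite /abs_sum big_nil.
rewrite /abs_sum big_cons -/(abs_sum s) => E; have := abs_sum_ge0 s => s0.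
have [a0|a0] := eqVneq a 0.
  have [|p [c [q [-> cE]]]] := IH; first lia.
  by exists p.+1, c, q; rewrite a0.
exists 0%N, a, (size s); split; last by lia.
by rewrite -abs_sum0 //; lia.
Qed.

(** * Covers in the lattice *)

(** The point [y] is the image of [x] under an affine reflection, recorded by the generators that
    conjugate it to a simple one. The search for covers thus stays inside the lattice;
    [refl_pair_cact] recovers the group element. *)
Inductive refl_pair : seq int -> seq int -> Prop :=
| ReflGen i x : (i <= size x)%N -> refl_pair x (act i x)
| ReflConj i x y : (i <= size x)%N ->
    refl_pair (act i x) (act i y) -> refl_pair x y.

Lemma refl_flip s v t : refl_pair (s ++ v :: t) (s ++ - v :: t).
Proof.
elim: t s v => [|b t IH] s v.
  rewrite -(act_opp _ (erefl (size s).+1)).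
  by apply: ReflGen; rewrite size_cat addn1.
apply: (@ReflConj (size s).+1); first by rewrite size_cat /=; lia.
by rewrite !act_swap // -!(cat_rcons b); apply: IH.
Qed.

Lemma refl_flip1 s v t : refl_pair (s ++ v :: t) (s ++ (1 - v) :: t).
Proof.
elim/last_ind: s t => [|s b IH] t; first exact: (@ReflGen 0).
rewrite !cat_rcons; apply: (@ReflConj (size s).+1).
  by rewrite size_cat /=; lia.
by rewrite !act_swap.
Qed.

Lemma refl_swap s a t b r :
  refl_pair (s ++ a :: t ++ b :: r) (s ++ b :: t ++ a :: r).
Proof.
elim: t s => [|c t IH] s /=.
  rewrite -(act_swap b a r (erefl (size s).+1)) -{2}(actK (size s).+1 (_ ++ _)).
  rewrite act_swap //; apply: (@ReflConj (size s).+1).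
    by rewrite size_cat /=; lia.
  by apply: ReflGen; rewrite size_act size_cat /=; lia.
apply: (@ReflConj (size s).+1); first by rewrite size_cat /=; lia.
by rewrite !act_swap // -!(cat_rcons c); apply: IH.
Qed.

(** Reflection in the wall x_1 + x_j = 1: a transposition conjugated by [s_0]. *)
Lemma refl_sum1 a t b r :
  refl_pair (a :: t ++ b :: r) ((1 - b) :: t ++ (1 - a) :: r).
Proof.
apply: (@ReflConj 0) => //=; rewrite subKr.
exact: (refl_swap [::]).
Qed.

(** Conjugation by the sign change of an arbitrary entry: carry the entry to the last position,
    negate it there, carry it back. *)
Lemma refl_conj_flip s v t s' v' t' : size s = size s' -> size t = size t' ->
  refl_pair (s ++ - v :: t) (s' ++ - v' :: t') ->
  refl_pair (s ++ v :: t) (s' ++ v' :: t').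
Proof.
elim: t s s' t' => [|b t IH] s s' [|b' t'] //= ss tt R.
  apply: (@ReflConj (size s).+1); first by rewrite size_cat addn1.
  by rewrite !act_opp ?ss.
apply: (@ReflConj (size s).+1); first by rewrite size_cat /=; lia.
rewrite !act_swap ?ss // -!(cat_rcons b) -!(cat_rcons b'); apply: IH.
- by rewrite !size_rcons ss.
- by case: tt.
rewrite !cat_rcons; apply: (@ReflConj (size s).+1).
  by rewrite size_cat /=; lia.
by rewrite !act_swap ?ss.
Qed.

(** Reflection in the wall x_1 - x_j = 1, obtained from that in x_1 + x_j = 1 by conjugating with
    the sign change of x_j. *)
Lemma refl_diff1 a t b r :
  refl_pair (a :: t ++ b :: r) ((b + 1) :: t ++ (a - 1) :: r).
Proof.
rewrite -!cat_cons; apply: refl_conj_flip => //=.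
have := refl_sum1 a t (- b) r; rewrite opprK opprB.
by rewrite (addrC 1 b).
Qed.

Lemma len_cons a s : len (a :: s) = crossings (a *+ 2) + row_len a s + len s.
Proof. by []. Qed.

Lemma row_len_cons c a s : row_len c (a :: s) = pair_len c a + row_len c s.
Proof. exact: big_cons. Qed.

Lemma row_len_cat c s t : row_len c (s ++ t) = row_len c s + row_len c t.
Proof. exact: big_cat. Qed.

Lemma row_len_eq a a' s : {in s, forall c, pair_len a c = pair_len a' c} ->
  row_len a s = row_len a' s.
Proof.
by move=> E; rewrite /row_len big_seq [RHS]big_seq; apply: eq_bigr => c /E.
Qed.

Lemma len_change1 (s : seq int) (v v' : int) (t : seq int) :
  {in s, forall c, pair_len c v = pair_len c v'} ->
  {in t, forall c, pair_len v c = pair_len v' c} ->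
  len (s ++ v :: t) + crossings (v' *+ 2) =
  len (s ++ v' :: t) + crossings (v *+ 2).
Proof.
elim: s => [|c s IH] Es Et.
  by rewrite !cat0s !len_cons (row_len_eq Et); lia.
rewrite !cat_cons !len_cons !row_len_cat !row_len_cons Es ?mem_head //.
by have := IH (fun d ds => Es d (mem_behead (s := c :: s) ds)) Et; lia.
Qed.

Definition col_len (s : seq int) b : int := \sum_(c <- s) pair_len c b.

Lemma len_insert t b r :
  len (t ++ b :: r) = len (t ++ r) + col_len t b + crossings (b *+ 2) + row_len b r.
Proof.
elim: t => [|c t IH].
  by rewrite !cat0s len_cons /col_len big_nil; lia.
have -> : col_len (c :: t) b = pair_len c b + col_len t b by apply: big_cons.
by rewrite !cat_cons !len_cons IH !row_len_cat row_len_cons; lia.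
Qed.

(** Only walls involving a moved entry can matter. The hypotheses balance the contributions of each
    remaining entry, so the two lengths are compared through the terms of the moved pair alone, and
    neither length is computed. *)
Lemma len_change2 (s : seq int) (a : int) (t : seq int) (b : int) (r : seq int)
  (a' b' : int) :
  {in s, forall c, pair_len c a + pair_len c b = pair_len c a' + pair_len c b'} ->
  {in t, forall c, pair_len a c + pair_len c b = pair_len a' c + pair_len c b'} ->
  {in r, forall c, pair_len a c + pair_len b c = pair_len a' c + pair_len b' c} ->
  len (s ++ a :: t ++ b :: r) +
    (crossings (a' *+ 2) + crossings (b' *+ 2) + pair_len a' b') =
  len (s ++ a' :: t ++ b' :: r) +
    (crossings (a *+ 2) + crossings (b *+ 2) + pair_len a b).
Proof.
elim: s => [|c s IH] Es Et Er; rewrite ?cat0s ?cat_cons !len_cons; last first.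
  have := Es c (mem_head _ _).
  have := IH (fun d ds => Es d (mem_behead (s := c :: s) ds)) Et Er.
  by rewrite !(row_len_cat, row_len_cons); lia.
rewrite !len_insert !row_len_cat !row_len_cons.
have : row_len a t + col_len t b = row_len a' t + col_len t b'.
  rewrite /row_len /col_len -!big_split big_seq [RHS]big_seq.
  by apply: eq_bigr => c /Et.
have : row_len a r + row_len b r = row_len a' r + row_len b' r.
  rewrite /row_len -!big_split big_seq [RHS]big_seq.
  by apply: eq_bigr => c /Er.
lia.
Qed.

Definition rcover (x y : seq int) : Prop := refl_pair x y /\ len x = len y + 1.

Definition two_covers (x : seq int) : Prop :=
  exists y1 y2, [/\ y1 <> y2, rcover x y1 & rcover x y2].

(** The second alternative yields two points of corank 2. Either alternative clashes with the single
    element in rank 1 or in rank 2. *)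
Definition branching (x : seq int) : Prop :=
  two_covers x \/ exists2 y, rcover x y & two_covers y.

Lemma rcover_act i x : (0 < size x)%N -> (i <= size x)%N -> aroot i x < 0 ->
  rcover x (act i x).
Proof. by move=> x0 ix r; split; [exact: ReflGen | exact: act_down]. Qed.

Lemma lin_act_neq k l x : (k < l < size x)%N -> lin_root k x != 0 ->
  lin_act k x <> lin_act l x.
Proof.
elim: k l x => [|k IH] [|l] [|a s] //= kl r; last first.
  by case=> /(IH l s kl r).
case: s kl r => [|b s] /= kl ab; first by lia.
by case=> E; move: ab; rewrite E subrr.
Qed.

Lemma two_descents i j x : (i < j <= size x)%N ->
  aroot i x < 0 -> aroot j x < 0 -> two_covers x.
Proof.
move=> /andP [ij jx] ri rj; exists (act i x), (act j x); split.
- case: i j ij jx ri rj => [|i] [|j] // ij jx ri rj; last first.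
    by apply: lin_act_neq; [rewrite -ltnS ij|rewrite lt_eqF].
  case: x jx ri rj => [|a s] //; case: j ij => [|j] _ /=; last first.
    by move=> _ ra _ [E _]; lia.
  by case: s => [|b s] /= _ ra rb [E1]; [lia | case; lia].
- by apply: rcover_act => //; lia.
- by apply: rcover_act => //; lia.
Qed.

Lemma decreasing_le (s : seq int) (a : int) (t : seq int) :
  (forall k, (k < size s)%N -> 0 <= lin_root k (s ++ a :: t)) ->
  {in s, forall c, a <= c <= head 0 s}.
Proof.
elim: s => //= c s IH rs d.
have {}IH := IH (fun k ks => rs k.+1 ks); have := rs 0%N isT.
case: s IH {rs} => [|e s] /= IH ce.
  by rewrite mem_seq1 => /eqP ->; lia.
by have := IH e (mem_head _ _) => E; rewrite in_cons => /predU1P [->|/IH]; lia.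
Qed.

Lemma all_eq_nseq (a : int) (s : seq int) :
  {in s, forall c, c = a} -> s = nseq (size s) a.
Proof. by move=> E; apply/all_pred1P/allP => c /E ->; apply: eqxx. Qed.

Lemma leading_block (v : int) s :
  exists r t, s = nseq r v ++ t /\ (t = [::] \/ exists e t', t = e :: t' /\ e <> v).
Proof.
elim: s => [|a s [r [t [-> tE]]]]; first by exists 0%N, [::]; split=> //; left.
have [->|av] := eqVneq a v; first by exists r.+1, t.
exists 0%N, (a :: nseq r v ++ t); split=> //; right.
by exists a, (nseq r v ++ t); split=> //; apply/eqP.
Qed.

Lemma trailing_block (v : int) s :
  exists t r, s = t ++ nseq r v /\
    (t = [::] \/ exists t' e, t = rcons t' e /\ e <> v).
Proof.
have [r [t [sE tE]]] := leading_block v (rev s).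
exists (rev t), r; rewrite -[s]revK sE rev_cat; split.
  by rewrite rev_nseq.
case: tE => [->|[e [t' [-> ev]]]]; [by left|right].
by exists (rev t'), e; rewrite rev_cons.
Qed.

Lemma crossings_cases d :
  0 < d /\ crossings d = d - 1 \/ d <= 0 /\ crossings d = - d.
Proof. by rewrite /crossings; case: ifP => ?; [left|right]; split=> //; lia. Qed.

Local Ltac crossings_lia :=
  rewrite /pair_len;
  repeat match goal with |- context [crossings ?d] =>
    have := crossings_cases d; move: (crossings d) => ? end; lia.

Local Ltac nseq_lia := move=> ? /nseqP [-> _]; crossings_lia.

Lemma rcover_flip (s : seq int) (v v' : int) (t : seq int) :
  v' = - v \/ v' = 1 - v ->
  {in s, forall c, pair_len c v = pair_len c v'} ->
  {in t, forall c, pair_len v c = pair_len v' c} ->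
  crossings (v *+ 2) = crossings (v' *+ 2) + 1 ->
  rcover (s ++ v :: t) (s ++ v' :: t).
Proof.
move=> vE Es Et E; split.
  by case: vE => ->; [apply: refl_flip | apply: refl_flip1].
by have := len_change1 Es Et; lia.
Qed.

Lemma rcover_two (s : seq int) (a : int) (t : seq int) (b : int) (r : seq int)
  (a' b' : int) :
  refl_pair (s ++ a :: t ++ b :: r) (s ++ a' :: t ++ b' :: r) ->
  {in s, forall c, pair_len c a + pair_len c b = pair_len c a' + pair_len c b'} ->
  {in t, forall c, pair_len a c + pair_len c b = pair_len a' c + pair_len c b'} ->
  {in r, forall c, pair_len a c + pair_len b c = pair_len a' c + pair_len b' c} ->
  crossings (a *+ 2) + crossings (b *+ 2) + pair_len a b =
    crossings (a' *+ 2) + crossings (b' *+ 2) + pair_len a' b' + 1 ->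
  rcover (s ++ a :: t ++ b :: r) (s ++ a' :: t ++ b' :: r).
Proof.
by move=> R Es Et Er E; split=> //; have := len_change2 Es Et Er; lia.
Qed.

(** If [c] comes first, the covers cross 2x_1 = 1 and x_1 + x_2 = 1. Otherwise [c] is exchanged with
    the 0 on its left, or the wall x_1 + x_j = 1 is crossed. *)
Lemma two_covers_pos p (c : int) q : 2 <= c -> (0 < p + q)%N ->
  two_covers (nseq p 0 ++ c :: nseq q 0).
Proof.
move=> c2; case: p => [|p] pq.
  case: q pq => // q _; exists ((1 - c) :: nseq q.+1 0), (1 :: (1 - c) :: nseq q 0).
  split; first by case; lia.
    by apply: (rcover_flip (s := [::])); [right| | nseq_lia | crossings_lia].
  have := refl_sum1 c [::] 0 (nseq q 0); rewrite subr0 => R.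
  by apply: (rcover_two (s := [::]) (t := [::]) R) => //; [nseq_lia | crossings_lia].
exists (nseq p 0 ++ c :: 0 :: nseq q 0), ((1 - c) :: nseq p 0 ++ 1 :: nseq q 0).
split.
- by case: p {pq} => [|p] [] //; lia.
- have xE : nseq p.+1 0 ++ c :: nseq q 0 = nseq p 0 ++ 0 :: c :: nseq q 0.
    by rewrite cat_nseq_cons.
  rewrite xE -(act_swap (i := p.+1) 0 c) ?size_nseq //; apply: rcover_act.
  + by rewrite size_cat /=; lia.
  + by rewrite size_cat size_nseq /=; lia.
  by rewrite aroot_swap ?size_nseq //; lia.
have := refl_sum1 0 (nseq p 0) c (nseq q 0); rewrite subr0 => R.
by apply: (rcover_two (s := [::]) R) => //; [nseq_lia | nseq_lia | crossings_lia].
Qed.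

(** One cover is the simple descent at [c]: exchange with the next 0, or sign change in the last
    position. The other crosses x_1 - x_j = 1, which uses the leading 0. *)
Lemma two_covers_neg p (c : int) q : c <= -2 ->
  two_covers (nseq p.+1 0 ++ c :: nseq q 0).
Proof.
move=> c2; have R := refl_diff1 0 (nseq p 0) c (nseq q 0).
have C : rcover (nseq p.+1 0 ++ c :: nseq q 0)
    ((c + 1) :: nseq p 0 ++ (0 - 1) :: nseq q 0).
  by apply: (rcover_two (s := [::]) R) => //; [nseq_lia | nseq_lia | crossings_lia].
set x := _ ++ _ in C *; set y := _ :: _ in C *.
exists (act p.+2 x), y; split=> //.
  rewrite /x /= /y; case: q {C R x y} => [|q] /=; first by case; lia.
  by case; lia.
apply: rcover_act; rewrite /x ?size_cat ?size_nseq /=; try lia.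
rewrite -[lin_root _ _]/(aroot p.+2 (nseq p.+1 0 ++ c :: nseq q 0)).
case: (q) => [|q'] /=.
  rewrite -[lin_root _ _]/(aroot p.+2 (nseq p.+1 0 ++ [:: c])).
  by rewrite aroot_opp ?size_nseq //; lia.
rewrite -[lin_root _ _]/(aroot p.+2 (nseq p.+1 0 ++ c :: 0 :: nseq q' 0)).
by rewrite aroot_swap ?size_nseq //; lia.
Qed.

Lemma branching_axis p (c : int) q : (0 < p + q)%N -> c <> 0 -> `|c| <> 1 ->
  branching (nseq p 0 ++ c :: nseq q 0).
Proof.
move=> pq c0 c1; have [c2|c2] := leP 2 c; first by left; apply: two_covers_pos.
have {}c2 : c <= -2 by lia.
case: p pq => [|p] pq; last by left; apply: two_covers_neg.
(* The point (c,0,...,0) with c <= -2 lacks the leading 0 of that construction; one step down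
   provides it, and the two covers appear in corank 2. *)
case: q pq => // q _; right; exists (0 :: c :: nseq q 0).
  by apply: (@rcover_act 1) => //=; lia.
exact: (@two_covers_neg 0).
Qed.

Lemma rcover_swap s a b t : a < b -> rcover (s ++ a :: b :: t) (s ++ b :: a :: t).
Proof.
move=> ab; rewrite -(act_swap (i := (size s).+1) a b) //; apply: rcover_act.
- by rewrite size_cat /=; lia.
- by rewrite size_cat /=; lia.
by rewrite aroot_swap //; lia.
Qed.

Lemma rcover_opp s a : a < 0 -> rcover (s ++ [:: a]) (s ++ [:: - a]).
Proof.
move=> a0; rewrite -(act_opp (i := (size s).+1) a) //; apply: rcover_act.
- by rewrite size_cat /=; lia.
- by rewrite size_cat /=; lia.
by rewrite aroot_opp.
Qed.

Lemma rcover_head (a : int) s : 1 <= a -> rcover (a :: s) ((1 - a) :: s).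
Proof. by move=> a1; apply: (@rcover_act 0) => //=; lia. Qed.

Lemma nseq_rcons (T : Type) k (a : T) s : nseq k.+1 a ++ s = nseq k a ++ a :: s.
Proof. by rewrite cat_nseq_cons. Qed.

Lemma cat_neq (s : seq int) a t b u : a <> b -> s ++ a :: t <> s ++ b :: u.
Proof. by move=> ab /(congr1 (drop (size s))); rewrite !drop_size_cat // => -[]. Qed.

(** Once the last entry is negated, the new entry [-v] can be exchanged with its left neighbour or
    reflected at 1/2. The positive constant case mirrors this at the first entry. *)
Lemma branching_const_neg k (v : int) : v < 0 -> branching (nseq k.+2 v).
Proof.
move=> v0; right; exists (nseq k.+1 v ++ [:: - v]).
  by rewrite -[nseq k.+2 v]cats0 nseq_rcons; apply: rcover_opp.
exists (nseq k v ++ - v :: [:: v]), (nseq k.+1 v ++ [:: 1 - - v]); split.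
- by rewrite nseq_rcons; apply: cat_neq; lia.
- by rewrite nseq_rcons; apply: rcover_swap; lia.
by apply: rcover_flip => //; [right | nseq_lia | crossings_lia].
Qed.

Lemma branching_const_pos k (a : int) : 2 <= a -> branching (nseq k.+2 a).
Proof.
move=> a2; right; exists ((1 - a) :: nseq k.+1 a); first by apply: rcover_head; lia.
exists (a :: (1 - a) :: nseq k a), (- (1 - a) :: nseq k.+1 a); split.
- by case; lia.
- by apply: (@rcover_swap [::]); lia.
by apply: (@rcover_flip [::]) => //; [left | nseq_lia | crossings_lia].
Qed.

(** Besides the descent at the last entry, the sign change of [e] loses only the wall 2x_j = 0: [e]
    is smaller in absolute value than the entries [v] behind it, so its walls with them balance. *)
Lemma two_covers_last_block s (e v : int) r : v < e -> e < 0 ->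
  {in s, forall c, e <= c <= 0} ->
  two_covers (s ++ e :: nseq r.+1 v).
Proof.
move=> ve e0 se; exists (s ++ e :: nseq r v ++ [:: - v]), (s ++ - e :: nseq r.+1 v).
split; first by apply: cat_neq; lia.
  have E z : s ++ e :: nseq r v ++ [:: z] = (s ++ e :: nseq r v) ++ [:: z].
    by rewrite -catA.
  by rewrite -[nseq r.+1 v]cats0 nseq_rcons !E; apply: rcover_opp; lia.
apply: rcover_flip => //; first by left.
- by move=> c _; rewrite pair_len_opp.
- by nseq_lia.
by crossings_lia.
Qed.

Lemma branching_last_block p (v : int) r : v < 0 ->
  branching (nseq p.+1 0 ++ nseq r.+2 v).
Proof.
move=> v0; right; exists (nseq p.+1 0 ++ nseq r.+1 v ++ [:: - v]).
  rewrite -[nseq r.+2 v]cats0 (nseq_rcons r.+1 v) !(catA (nseq p.+1 0)).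
  exact: rcover_opp.
(* The new last entry [-v] is exchanged either with its neighbour [v] or, across the whole block,
   with the last 0 before it. *)
exists (nseq p.+1 0 ++ nseq r v ++ - v :: [:: v]),
  (nseq p 0 ++ - v :: nseq r.+1 v ++ [:: 0]).
split.
- by rewrite (nseq_rcons p); apply: cat_neq; lia.
- by rewrite (nseq_rcons r v) !(catA (nseq p.+1 0)); apply: rcover_swap; lia.
rewrite (nseq_rcons p); apply: rcover_two.
- exact: refl_swap.
- by nseq_lia.
- by nseq_lia.
- by [].
by crossings_lia.
Qed.

Lemma two_covers_first_block (a e : int) r t : 1 <= e -> e < a ->
  {in t, forall c, 0 <= c <= e} ->
  two_covers (nseq r.+1 a ++ e :: t).
Proof.
move=> e1 ea te; exists ((1 - a) :: nseq r a ++ e :: t), (nseq r.+1 a ++ (1 - e) :: t).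
split; first by case; lia.
  by apply: rcover_head; lia.
apply: rcover_flip => //; first by right.
- by nseq_lia.
- by move=> c _; rewrite pair_len_flip.
by crossings_lia.
Qed.

Lemma branching_first_block (a : int) r q : 2 <= a ->
  branching (nseq r.+2 a ++ 0 :: nseq q 0).
Proof.
move=> a2; right; exists ((1 - a) :: nseq r.+1 a ++ 0 :: nseq q 0).
  by apply: rcover_head; lia.
exists (a :: (1 - a) :: nseq r a ++ 0 :: nseq q 0),
  (0 :: nseq r.+1 a ++ (1 - a) :: nseq q 0).
split.
- by case; lia.
- by apply: (@rcover_swap [::]); lia.
apply: (@rcover_two [::]).
- exact: (refl_swap [::]).
- by [].
- by nseq_lia.
- by nseq_lia.
by crossings_lia.
Qed.

(** A second descent gives two covers at once. Otherwise the entries up to [a] decrease within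
    [a, 0] and those from [b] on decrease within [0, b]. After the exchange of [a] and [b] both
    neighbouring positions are descents, unless at most one entry of the point is nonzero, which the
    hypothesis excludes. *)
Lemma branching_ascent s (a b : int) t : a < b ->
  (forall p c q, s ++ a :: b :: t <> nseq p 0 ++ c :: nseq q 0) ->
  branching (s ++ a :: b :: t).
Proof.
move=> ab Nx; set x := s ++ a :: b :: t; set i := (size s).+1.
have xsz : size x = (size s + (size t).+2)%N by rewrite size_cat.
have ri : aroot i x < 0 by rewrite aroot_swap //; lia.
have [[j [jx ji rj]]|Nd] :=
  pselect (exists j, [/\ (j <= size x)%N, j <> i & aroot j x < 0]).
  left; have [lt_ij|lt_ji] : ((i < j) \/ (j < i))%N by lia.
    by apply: (two_descents (i := i) (j := j)) => //; rewrite lt_ij.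
  by apply: (two_descents (i := j) (j := i)) => //; rewrite lt_ji xsz /i; lia.
have rx j : (j <= size x)%N -> j <> i -> 0 <= aroot j x.
  by move=> jx ji; rewrite leNgt; apply/negP => r; apply: Nd; exists j.
have tb : {in b :: t, forall c, 0 <= c <= b}.
  apply: lin_root_ge0 => k /= kt.
  have xE : x = (s ++ [:: a]) ++ b :: t by rewrite -catA.
  have := rx (size (s ++ [:: a]) + k).+1; rewrite xE /= lin_root_cat.
  by apply; rewrite !size_cat /i /=; lia.
have sa : {in s ++ [:: a], forall c, a <= c <= 0}.
  have E : {in s, forall c, a <= c <= head 0 s}.
    apply: (decreasing_le (t := b :: t)) => k ks.
    by apply: (rx k.+1); rewrite ?xsz /i; lia.
  have h0 : head a s <= 0.
    have := rx 0%N isT; rewrite /x /i.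
    by case: (s) => [|c s'] /= /(_ (@O_S _)); lia.
  move=> c; rewrite mem_cat mem_seq1 => /orP [cs|/eqP ->].
    by have := E c cs; move: h0 cs; case: (s) => //= d s'; lia.
  move: h0 E; case: (s) => [|d s'] /= h0 E; first by lia.
  by have := E d (mem_head _ _); lia.
have a0 : a <= a <= 0 by apply: sa; rewrite mem_cat mem_seq1 eqxx orbT.
have b0 := tb b (mem_head _ _).
right; exists (s ++ b :: a :: t); first exact: rcover_swap.
set y := s ++ b :: a :: t.
have ysz : size y = (size s + (size t).+2)%N by rewrite size_cat.
have dec_s s' c : s = rcons s' c -> {in s', forall d, c <= d}.
  move=> sE d ds'; suff : c <= d <= head 0 s' by case/andP.
  apply: (decreasing_le (t := [:: a, b & t])) ds' => k ks'.
  have := rx k.+1; rewrite /= /x sE cat_rcons; apply.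
    by rewrite size_cat /=; lia.
  by rewrite /i sE size_rcons; lia.
have dec_t d t' : t = d :: t' -> {in t', forall c, c <= d}.
  move=> tE c ct'; suff : 0 <= c <= d by case/andP.
  apply: (lin_root_ge0 (x := d :: t')); last by rewrite in_cons ct' orbT.
  move=> k /= kt.
  have xE : x = (s ++ [:: a; b]) ++ d :: t' by rewrite -catA -tE.
  have := rx (size (s ++ [:: a; b]) + k).+1; rewrite xE /= lin_root_cat; apply.
    by rewrite !size_cat /=; lia.
  by rewrite !size_cat /i /=; lia.
have left_neg : aroot i.-1 y < 0.
  rewrite ltNge; apply/negP => L; suff [b00 s00] : b = 0 /\ {in s, forall c, c = 0}.
    apply: (Nx (size s) a (size (b :: t))).
    rewrite -(all_eq_nseq s00) -(all_eq_nseq (s := b :: t)) // => c /tb; lia.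
  have [sE|[s' [c sE]]] : s = [::] \/ exists s' c, s = rcons s' c.
    by case/lastP: (s) => [|s' c]; [left|right; exists s', c].
    by split; [move: L; rewrite /y /i sE /=; lia | rewrite sE].
  have ci : c \in s ++ [:: a] by rewrite sE mem_cat mem_rcons mem_head.
  have := sa c ci; move: L; rewrite /y /i sE size_rcons cat_rcons aroot_swap // => L cE.
  split; first by lia.
  move=> d; rewrite mem_rcons in_cons => /predU1P [->|ds']; first by lia.
  have := dec_s _ _ sE d ds'.
  have : d \in s ++ [:: a] by rewrite sE mem_cat mem_rcons in_cons ds' orbT.
  by move/sa; lia.
have right_neg : aroot i.+1 y < 0.
  rewrite ltNge; apply/negP => L; suff [a00 t00] : a = 0 /\ {in t, forall c, c = 0}.
    apply: (Nx (size (s ++ [:: a])) b (size t)).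
    rewrite -(all_eq_nseq (s := s ++ [:: a])) -?(all_eq_nseq t00) -?catA //.
    by move=> c /sa; lia.
  have yE : y = (s ++ [:: b]) ++ a :: t by rewrite -catA.
  have iE : i = size (s ++ [:: b]) by rewrite size_cat addn1.
  move: L; rewrite yE iE; case tE: t => [|d t'].
    by rewrite aroot_opp // => L; split=> //; lia.
  rewrite aroot_swap // => L.
  have di : d \in b :: t by rewrite tE !in_cons eqxx orbT.
  have := tb d di => dE; split; first by lia.
  move=> c; rewrite in_cons => /predU1P [->|ct']; first by lia.
  have := dec_t _ _ tE c ct'.
  have : c \in b :: t by rewrite tE !in_cons ct' !orbT.
  by move/tb; lia.
by apply: (two_descents (i := i.-1) (j := i.+1)) => //; rewrite ysz /i; lia.
Qed.

Lemma ascentP x :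
  (exists s a b t, x = s ++ a :: b :: t /\ a < b) \/
  (forall k, (k.+1 < size x)%N -> 0 <= lin_root k x).
Proof.
have [[k [kx r]]|N] :=
  pselect (exists k, (k.+1 < size x)%N /\ lin_root k x < 0); last first.
  by right=> k kx; rewrite leNgt; apply/negP => r; apply: N; exists k.
left; exists (take k x), (nth 0 x k), (nth 0 x k.+1), (drop k.+2 x).
have xE : x = take k x ++ nth 0 x k :: nth 0 x k.+1 :: drop k.+2 x.
  by rewrite -(drop_nth 0 kx) -(drop_nth 0 (ltnW kx)) cat_take_drop.
split=> //; move: r; rewrite {1}xE -[lin_root _ _]/(aroot k.+1 _) aroot_swap; first lia.
by rewrite size_takel // ltnW // ltnW.
Qed.

Lemma special_or_branching x : (1 < size x)%N ->
  [\/ branching x, x = nseq (size x) 0, abs_sum x = 1 |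
      exists2 k, (0 < k <= size x)%N & x = nseq k 1 ++ nseq (size x - k) 0].
Proof.
move=> x1.
have axis p c q : x = nseq p 0 ++ c :: nseq q 0 ->
    [\/ branching x, x = nseq (size x) 0 | abs_sum x = 1].
  move=> xE; have [c0|c0] := eqVneq c 0.
    by apply: Or32; apply: all_eq_nseq => d; rewrite xE c0 mem_cat in_cons => /or3P
       [/nseqP [] //|/eqP //|/nseqP [] //].
  have [c1|c1] := eqVneq `|c| 1.
    apply: Or33; rewrite xE /abs_sum big_cat big_cons /= c1.
    by rewrite !big_seq !big1 ?addr0 ?add0r // => d /nseqP [->].
  apply: Or31; rewrite xE; apply: branching_axis; last 2 first.
  - exact/eqP.
  - exact/eqP.
  by move: x1; rewrite xE size_cat /= !size_nseq; lia.
have [[p [c [q /axis [B|O|A]]]]|Nx] :=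
  pselect (exists p c q, x = nseq p 0 ++ c :: nseq q 0).
- exact: Or41.
- exact: Or42.
- exact: Or43.
have {}Nx p c q : x <> nseq p 0 ++ c :: nseq q 0.
  by move=> E; apply: Nx; exists p, c, q.
have [[s [a [b [t [xE ab]]]]]|dec] := ascentP x.
  by apply: Or41; rewrite xE; apply: branching_ascent => // p c q; rewrite -xE.
have xlast : forall s' v, x = rcons s' v -> {in s', forall c, v <= c <= head 0 s'}.
  move=> s' v xE; apply: (decreasing_le (t := [::])) => k ks.
  by rewrite cats1 -xE; apply: dec; rewrite xE size_rcons.
have xtail s t e : x = s ++ e :: t -> {in t, forall c, 0 <= c} -> 0 <= e ->
    {in t, forall c, c <= e}.
  move=> xE t0 e0 c ct; suff : 0 <= c <= e by case/andP.
  apply: (lin_root_ge0 (x := e :: t)); last by rewrite in_cons ct orbT.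
  move=> k /= kt; have [k1|k1] := ltnP k (size t).
    have := dec (size s + k)%N; rewrite xE lin_root_cat; apply.
    by rewrite size_cat /=; lia.
  have -> : k = size t by lia.
  by case/lastP: (t) t0 => [|t' d] // t0; rewrite size_rcons -cats1
    -[lin_root _ _]/(aroot (size (e :: t')).+1 ((e :: t') ++ [:: d])) aroot_opp //;
    apply: t0; rewrite mem_rcons mem_head.
have [s [v xE]] : exists s v, x = rcons s v.
  by case/lastP: (x) x1 => // s v; exists s, v.
have [b [t xE']] : exists b t, x = b :: t.
  by case: (x) x1 => // b t; exists b, t.
have xH := xE'; have xv : {in x, forall c, v <= c <= b}.
  have E := xlast _ _ xE; have hb : s <> [::] -> head 0 s = b.
    by move: xE'; rewrite xE; case: (s) => //= ? ? [].
  have sn : s <> [::] by move=> s0; move: x1; rewrite xE s0.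
  rewrite (hb sn) in E => c; rewrite xE mem_rcons in_cons => /predU1P [->|/E //].
  have [d ds] : exists d, d \in s.
    by case: (s) sn => // d s' _; exists d; rewrite mem_head.
  by have := E d ds; lia.
(* The point now decreases from [b] to [v]. If both ends are descents they give two covers;
   otherwise all entries have one sign, and the extreme block, last or first, together with its
   neighbour decides. *)
have [v0|v0] := ltP v 0; have [b0|b0] := leP b 0.
- have {xE'} [t1 [r [xE' tE]]] := trailing_block v x.
  case: tE => [t10|[t' [e [tE ev]]]].
    apply: Or41; rewrite xE' t10 /=; move: x1; rewrite xE' t10 size_nseq.
    by case: r {xE'} => [|[|r]] // _; apply: branching_const_neg.
  have {t1 tE xE'} xE' : x = t' ++ e :: nseq r v by rewrite xE' tE cat_rcons.
  have r0 : (0 < r)%N.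
    rewrite lt0n; apply/eqP => r0; move: xE'; rewrite r0 xE cats1.
    by move/rcons_inj => [_ ve]; apply: ev.
  case: r r0 xE' => // r _ xE'.
  have ein : e \in x by rewrite xE' mem_cat mem_head orbT.
  have ee : v <= e <= b := xv e ein.
  have t'e : {in t', forall c, e <= c <= 0}.
    move=> c ct'; have cx : c \in x by rewrite xE' mem_cat ct'.
    have := xv c cx; suff : e <= c <= head 0 t' by lia.
    apply: (decreasing_le (t := nseq r.+1 v)) ct' => k kt'.
    by rewrite -xE'; apply: dec; rewrite xE' size_cat /=; lia.
  have [e0|e0] := ltP e 0.
    by apply: Or41; left; rewrite xE'; apply: two_covers_last_block => //; lia.
  have e00 : e = 0 by lia.
  have t'0 : t' = nseq (size t') 0.
    by apply: all_eq_nseq => c /t'e; lia.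
  have {}xE' : x = nseq (size t').+1 0 ++ nseq r.+1 v.
    by rewrite xE' {1}t'0 e00 nseq_rcons.
  case: r xE' => [|r] xE'; first by case: (Nx (size t').+1 v 0%N).
  by apply: Or41; rewrite xE'; apply: branching_last_block.
- apply: Or41; left; apply: (two_descents (i := 0%N) (j := size x)).
  + by rewrite leqnn andbT; lia.
  + by rewrite xE' /=; lia.
  by rewrite xE -cats1 aroot_opp // size_cat addn1.
- have := xv b; rewrite {1}xE' mem_head => /(_ isT) bv.
  apply: Or42; apply: all_eq_nseq => c /xv; lia.
have {xE'} [r [t1 [xE' tE]]] := leading_block b x.
case: tE => [t10|[e [t' [tE eb]]]].
  rewrite t10 cats0 in xE'; have [b1|b1] := eqVneq b 1.
    apply: Or44; exists (size x); first by rewrite leqnn andbT; lia.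
    by rewrite subnn cats0 {1}xE' b1 xE' size_nseq.
  apply: Or41; rewrite xE'; move: x1; rewrite xE' size_nseq.
  by case: r {xE'} => [|[|r]] // _; apply: branching_const_pos; lia.
rewrite tE in xE' => {t1 tE}.
have ein : e \in x by rewrite xE' mem_cat mem_head orbT.
have ee := xv e ein.
have t'e : {in t', forall c, 0 <= c <= e}.
  have t'0 : {in t', forall c, 0 <= c}.
    move=> c ct'; have cx : c \in x by rewrite xE' mem_cat in_cons ct' !orbT.
    by have := xv c cx; lia.
  by move=> c ct'; rewrite t'0 //=; apply: (xtail _ _ _ xE') => //; lia.
have r0 : (0 < r)%N.
  by rewrite lt0n; apply/eqP => r0; move: xE'; rewrite r0 xH => -[be _]; apply: eb.
case: r r0 xE' => // r _ xE'.
have [e0|e0] := ltP 0 e.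
  by apply: Or41; left; rewrite xE'; apply: two_covers_first_block => //; lia.
have e00 : e = 0 by lia.
have t'0 : t' = nseq (size t') 0 by apply: all_eq_nseq => c /t'e; lia.
have [b1|b1] := eqVneq b 1.
  apply: Or44; exists r.+1; first by rewrite xE' size_cat size_nseq /=; lia.
  rewrite {1}xE' {1}t'0 e00 b1; congr (_ ++ _).
  by rewrite xE' size_cat size_nseq addKn.
rewrite e00 t'0 in xE'.
case: r xE' => [|r] xE'; first by case: (Nx 0%N b (size t').+1).
by apply: Or41; rewrite xE'; apply: branching_first_block; lia.
Qed.
End Lattice.

(** * Cosets and lattice points *)

Section Action.
Variables (n : nat) (hn : 1 < n).
Local Notation I := 'I_n.+1.
Local Notation W := (affC n).
Local Notation m := (@affC_mx n).
Local Notation word := (cword m).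
Local Notation gen := (cgen m).
Local Notation S := (@affS n).
Local Open Scope group_scope.
Local Open Scope ring_scope.

Definition acts (a : seq I) (x : seq int) : seq int :=
  foldr (fun i : I => act i) x a.

Definition origin : seq int := nseq n 0.

Lemma acts_cat a b x : acts (a ++ b) x = acts a (acts b x).
Proof. exact: foldr_cat. Qed.

Lemma size_acts a x : size (acts a x) = size x.
Proof. by elim: a => //= i a IH; rewrite size_act. Qed.

Lemma affC_mxC (i j : I) : m i j = m j i.
Proof. by rewrite /affC_mx eq_sym orbC minnC maxnC. Qed.

Definition commuting_pair (i j : I) : Prop :=
  forall x, size x = n ->
  [/\ act i (act j x) = act j (act i x),
      aroot i (act j x) = aroot i x & aroot j (act i x) = aroot j x].

Definition braided_pair (i j : I) : Prop :=
  forall x, size x = n ->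
  [/\ act i (act j (act i x)) = act j (act i (act j x)),
      aroot i (act j x) = aroot i x + aroot j x &
      aroot j (act i x) = aroot j x + aroot i x].

(** The factor 2 marks [i] as the longer root in the scale of [aroot]; the relation is therefore not
    symmetric and [dihedral] offers both orders. *)
Definition double_pair (i j : I) : Prop :=
  forall x, size x = n ->
  [/\ act i (act j (act i (act j x))) = act j (act i (act j (act i x))),
      aroot i (act j x) = aroot i x + aroot j x *+ 2 &
      aroot j (act i x) = aroot j x + aroot i x].

Lemma dihedral (i j : I) : i != j ->
  [\/ m i j = 2 /\ commuting_pair i j, m i j = 3 /\ braided_pair i j |
      m i j = 4 /\ (double_pair i j \/ double_pair j i)].
Proof.
move=> ij; wlog lt_ij : i j ij / (i < j)%N => [wl|].
  have [|ji|/val_inj/eqP] := ltngtP i j; [exact: wl| |by rewrite (negPf ij)].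
  have ji' : j != i by rewrite eq_sym.
  have [[E c]|[E b]|[E d]] := wl j i ji' ji; rewrite affC_mxC E.
  - by apply: Or31; split=> // x /c [].
  - by apply: Or32; split=> // x /b [].
  by apply: Or33; split=> //; case: d => d; [right|left].
have mE : m i j = if i.+1 == j :> nat then
    if (i == 0%N :> nat) || (j == n :> nat) then 4 else 3 else 2.
  rewrite /affC_mx (negPf ij) (minn_idPl (ltnW lt_ij)) (maxn_idPr (ltnW lt_ij)).
  have -> : (j.+1 == i) = false by lia.
  by rewrite orbF.
have jn := ltn_ord j; have [ji|ji] := eqVneq i.+1 (j : nat); last first.
  rewrite (negPf ji) in mE; apply: Or31; split=> // x xn.
  by apply: act_far; rewrite ?xn; lia.
rewrite -ji eqxx in mE jn *; have [i0|i0] := eqVneq (i : nat) 0%N.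
  rewrite i0 /= in mE; apply: Or33; split=> //; left => x xn.
  by rewrite -ji i0; have [|E1 E2 E3] := @act_first x; rewrite ?xn.
rewrite (negPf i0) /= in mE; have [iN|iN] := eqVneq i.+1 n.
  rewrite iN eqxx in mE; apply: Or33; split=> //; left => x xn.
  by rewrite -ji; apply: act_last; rewrite ?xn -?iN; lia.
rewrite (negPf iN) in mE; apply: Or32; split=> // x xn.
by rewrite -ji; apply: act_near; rewrite ?xn; lia.
Qed.

Lemma acts_braid (i j : I) x : size x = n ->
  acts (flatten (nseq (m i j) [:: i; j])) x = x.
Proof.
move=> xn; have [->|ij] := eqVneq i j.
  by rewrite /affC_mx eqxx /= actK.
have [[-> c]|[-> b]|[-> [d|d]]] := dihedral ij; rewrite /=.
- by have [-> _ _] := c x xn; rewrite !actK.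
- by have [<- _ _] := b x xn; rewrite !actK.
- by have [-> _ _] := d x xn; rewrite !actK.
by have [<- _ _] := d x xn; rewrite !actK.
Qed.

Lemma acts_eq a b x : size x = n -> coxeq m a b -> acts a x = acts b x.
Proof.
move=> xn ab; elim: ab x xn => {a b} [i|i j|a b c d _ IHab _ IHcd|//|a b _ IH|
  a b c _ IHab _ IHbc] x xn.
- exact: actK.
- exact: acts_braid.
- by rewrite !acts_cat IHcd // IHab // size_acts.
- by rewrite IH.
- by rewrite IHab // IHbc.
Qed.

Definition cact (w : W) (x : seq int) : seq int := acts (repr w) x.

Lemma cact_word a x : size x = n -> cact (word a) x = acts a x.
Proof. by move=> xn; apply: acts_eq => //; apply/cwordP; rewrite /cword reprK. Qed.

Lemma size_cact w x : size (cact w x) = size x.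
Proof. exact: size_acts. Qed.

Lemma cactM (u v : W) x : size x = n -> cact (u * v)%g x = cact u (cact v x).
Proof.
move=> xn; have [a <-] := cword_surj u; have [b <-] := cword_surj v.
by rewrite -word_cat !cact_word ?size_acts // acts_cat.
Qed.

Definition pt (w : W) : seq int := cact w origin.

Lemma size_origin : size origin = n. Proof. exact: size_nseq. Qed.

Lemma size_pt w : size (pt w) = n.
Proof. by rewrite size_cact size_origin. Qed.

Lemma pt_word a : pt (word a) = acts a origin.
Proof. exact: cact_word size_origin. Qed.

Lemma ptM (u v : W) : pt (u * v)%g = cact u (pt v).
Proof. exact: cactM size_origin. Qed.

Lemma aroot_origin (i : I) : aroot i origin = (i == ord0)%:R.
Proof.
rewrite /origin; case: i => [[|k] /= kn].
  by case: n hn => // n' _ /=; rewrite mul0rn subr0.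
exact: lin_root_nseq0.
Qed.

Lemma act_origin (i : I) : S i -> act i origin = origin.
Proof.
move=> iS; apply: act_fix; rewrite ?size_origin //; first lia.
  by rewrite -ltnS.
by rewrite aroot_origin (negPf iS).
Qed.

Lemma cact_parabolic v : parabolic S v -> pt v = origin.
Proof.
case=> a aS <-; rewrite pt_word; elim: a aS => //= i a IH /andP [iS /IH ->].
exact: act_origin.
Qed.

Lemma ptM_parabolic w v : parabolic S v -> pt (w * v)%g = pt w.
Proof. by move=> vS; rewrite ptM cact_parabolic. Qed.

(** * Lengths, descending words and the stabiliser of the origin *)

Lemma len_origin : len origin = 0.
Proof.
rewrite /origin; elim: (n) => //= k ->; rewrite addr0 mul0rn /row_len.
by rewrite big_seq big1 // => b /nseqP [-> _].
Qed.

Lemma act_size_ok (i : I) (x : seq int) :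
  size x = n -> (0 < size x)%N /\ (i <= size x)%N.
Proof. by move=> ->; split; [lia|have := ltn_ord i; lia]. Qed.

Lemma len_act_le (i : I) x : size x = n -> len (act i x) <= len x + 1.
Proof.
move=> /act_size_ok -/(_ i) [x0 ix]; have [r|r|r] := ltgtP 0 (aroot i x).
- by rewrite act_up.
- by have := act_down x0 ix r; lia.
by rewrite act_fix //; lia.
Qed.

Lemma len_acts_le a : len (acts a origin) <= (size a)%:Z.
Proof.
elim: a => [|i a IH] /=; first by rewrite len_origin.
have := @len_act_le i (acts a origin); rewrite size_acts size_origin.
by move/(_ erefl); lia.
Qed.

Lemma len_pt_le w : len (pt w) <= (clen w)%:Z.
Proof. by have [a <- <-] := clen_word w; rewrite pt_word len_acts_le. Qed.

(** A path of descents from [x] to the origin. Its letters turn out to spell the minimal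
    representative of the coset of [x] ([down_minreps]). *)
Inductive down : seq int -> seq I -> Prop :=
| DownNil : down origin [::]
| DownCons (i : I) x a : size x = n -> aroot i x < 0 -> down (act i x) a ->
    down x (i :: a).

Lemma down_len x a : down x a -> len x = (size a)%:Z.
Proof.
elim=> {x a} [|i x a xn r _ IH]; first exact: len_origin.
have [x0 ix] := act_size_ok i xn.
by rewrite (act_down x0 ix r) IH /=; lia.
Qed.

Lemma down_acts x a : down x a -> acts a origin = x.
Proof. by elim=> {x a} //= i x a xn r _ ->; rewrite actK. Qed.

Lemma down_ex x : size x = n -> exists a, down x a.
Proof.
have [k] := ubnP `|len x|%N; elim: k x => // k IH x; rewrite ltnS => lk xn.
have [[i r]|Nr] := pselect (exists i : I, aroot i x < 0).
  have [x0 ix] := act_size_ok i xn; have := act_down x0 ix r.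
  have := len_ge0 (act i x) => l0 l1.
  have [a da] : exists a, down (act i x) a.
    by apply: IH; rewrite ?size_act //; lia.
  by exists (i :: a); apply: DownCons.
exists [::]; rewrite (@aroot_ge0 x) xn; first exact: DownNil.
  by lia.
move=> i; rewrite -ltnS => lin; rewrite leNgt; apply/negP => r.
by apply: Nr; exists (Ordinal lin).
Qed.

Definition same_coset (u v : W) : Prop := parabolic S (u^-1 * v)%g.

Lemma same_coset_refl u : same_coset u u.
Proof. by rewrite /same_coset mulVg; apply: parabolic1. Qed.

Lemma same_coset_sym u v : same_coset u v -> same_coset v u.
Proof. by move/parabolicV; rewrite invgM invgK. Qed.

Lemma same_coset_trans v u w :
  same_coset u v -> same_coset v w -> same_coset u w.
Proof. by move=> uv vw; have := parabolicM uv vw; rewrite -mulgA mulVKg. Qed.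

Lemma same_coset_mull g u v : same_coset u v -> same_coset (g * u)%g (g * v)%g.
Proof. by rewrite /same_coset invgM -mulgA mulKg. Qed.

Lemma same_coset_cons i a b : same_coset (word a) (word b) ->
  same_coset (word (i :: a)) (word (i :: b)).
Proof. by rewrite !(word_cons _ i); apply: same_coset_mull. Qed.

Lemma gen_braid i j : ((gen i * gen j) ^+ m i j = 1)%g.
Proof. by rewrite -word_nseq2; apply/cwordP/CoxBraid. Qed.

Lemma word_braid2 i j a : m i j = 2 -> word [:: i, j & a] = word [:: j, i & a].
Proof.
move=> mij; have := gen_braid i j; rewrite mij expgS expg1 => /mulg1_eq.
by rewrite !word_cons !mulgA invgM !gen_inv => ->.
Qed.

Lemma word_braid3 i j a : m i j = 3 ->
  word [:: i, j, i & a] = word [:: j, i, j & a].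
Proof.
move=> mij; have : (gen i * gen j * gen i * (gen j * gen i * gen j) = 1)%g.
  by rewrite -(gen_braid i j) mij !expgS expg0 mulg1 !mulgA.
move/mulg1_eq; rewrite !invgM !gen_inv !word_cons => E.
by rewrite !mulgA -E !mulgA.
Qed.

Lemma word_braid4 i j a : m i j = 4 ->
  word [:: i, j, i, j & a] = word [:: j, i, j, i & a].
Proof.
move=> mij.
have : (gen i * gen j * gen i * gen j * (gen i * gen j * gen i * gen j) = 1)%g.
  by rewrite -(gen_braid i j) mij !expgS expg0 mulg1 !mulgA.
move/mulg1_eq; rewrite !invgM !gen_inv !word_cons => E.
by rewrite !mulgA -E !mulgA.
Qed.

Lemma down_size0 a : down origin a -> a = [::].
Proof.
by move/down_len; rewrite len_origin; case: a.
Qed.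

Lemma down_inv i x a : down x (i :: a) ->
  [/\ size x = n, aroot i x < 0 & down (act i x) a].
Proof. by move=> d; inversion d. Qed.

Lemma aroot_actN (i : I) x : size x = n -> aroot i (act i x) = - aroot i x.
Proof. by move=> /act_size_ok -/(_ i) [x0 ix]; apply: aroot_act. Qed.

Lemma double_descents (i j : I) x : size x = n -> double_pair i j ->
  aroot i x < 0 -> aroot j x < 0 ->
  exists c, down (act i x) [:: j, i, j & c] /\ down (act j x) [:: i, j, i & c].
Proof.
move=> xn dp ri rj.
have [c dc] : exists c, down (act j (act i (act j (act i x)))) c.
  by apply: down_ex; rewrite !size_act.
have sz a : size (acts a x) = n by rewrite size_acts.
have [E1 E2 E3] := dp x xn.
have [_ F2 _] := dp _ (sz [:: i]); have [_ _ F3] := dp _ (sz [:: j]).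
have [_ _ G3] := dp _ (sz [:: j; i]); have [_ G2 _] := dp _ (sz [:: i; j]).
have Ni := aroot_actN i xn; have Nj := aroot_actN j xn.
have Nji := aroot_actN j (sz [:: i]); have Nij := aroot_actN i (sz [:: j]).
rewrite /= in F2 F3 G2 G3 Nji Nij.
by exists c; split; do 3! (apply: DownCons; rewrite ?size_act //; try lia);
  rewrite ?E1.
Qed.

Lemma joint_descents (i j : I) x : size x = n -> i != j ->
  aroot i x < 0 -> aroot j x < 0 ->
  exists p q, [/\ down (act i x) p, down (act j x) q &
    word (i :: p) = word (j :: q)].
Proof.
move=> xn ij ri rj; have sz a : size (acts a x) = n by rewrite size_acts.
have Ni := aroot_actN i xn; have Nj := aroot_actN j xn.
have [[mij cp]|[mij bp]|[mij dp]] := dihedral ij.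
- have [E1 E2 E3] := cp x xn.
  have [c dc] : exists c, down (act j (act i x)) c by apply/down_ex/(sz [:: j; i]).
  exists (j :: c), (i :: c); split; last exact: word_braid2.
    by apply: DownCons; rewrite ?size_act ?E3.
  by apply: DownCons; rewrite ?size_act ?E2 ?E1.
- have [E1 E2 E3] := bp x xn.
  have [_ F2 _] := bp _ (sz [:: i]); have [_ _ F3] := bp _ (sz [:: j]).
  have [c dc] : exists c, down (act i (act j (act i x))) c.
    exact/down_ex/(sz [:: i; j; i]).
  rewrite /= in F2 F3.
  exists [:: j, i & c], [:: i, j & c]; split; last exact: word_braid3.
    by do 2! (apply: DownCons; rewrite ?size_act //; try lia).
  by do 2! (apply: DownCons; rewrite ?size_act //; try lia); rewrite -E1.
case: dp => dp.
  have [c [d1 d2]] := double_descents xn dp ri rj.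
  by exists [:: j, i, j & c], [:: i, j, i & c]; split=> //; apply: word_braid4.
have [c [d1 d2]] := double_descents xn dp rj ri.
by exists [:: j, i, j & c], [:: i, j, i & c]; split=> //; apply: word_braid4.
Qed.

(** Since [s_i] fixes [x], the dihedral orbit of [x] is a path of m points. The braid relation
    carries the letter [i] past [j :: p] to the bottom [y] of this path, where it becomes a
    generator [l] fixing [y]. Here [p] is empty, [[:: i]] or [[:: i; j]] for m = 2, 3, 4. *)
Lemma sliding_generator (i j : I) x : size x = n ->
  aroot i x = 0 -> aroot j x < 0 ->
  exists p (l : I) y c, [/\ down (act j x) (p ++ c), down y c, aroot l y = 0,
    len y < len x & forall d, word [:: i, j & p ++ d] = word (j :: p ++ l :: d)].
Proof.
move=> xn ri rj; have sz a : size (acts a x) = n by rewrite size_acts.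
have ij : i != j by apply: contraTneq rj => <-; rewrite ri ltxx.
have Nj := aroot_actN j xn; have Nij := aroot_actN i (sz [:: j]).
have Njij := aroot_actN j (sz [:: i; j]).
have lenE p c y : down (act j x) (p ++ c) -> down y c -> len y < len x.
  have [x0 jx] := act_size_ok j xn; rewrite (act_down x0 jx rj).
  by move/down_len=> -> /down_len ->; rewrite size_cat; lia.
rewrite /= in Nij Njij.
suff [p [l [y [c [d1 d2 E F]]]]] : exists p (l : I) y c, [/\ down (act j x) (p ++ c),
    down y c, aroot l y = 0 &
    forall d, word [:: i, j & p ++ d] = word (j :: p ++ l :: d)].
  by exists p, l, y, c; split=> //; apply: lenE d1 d2.
have [[mij cp]|[mij bp]|[mij dp]] := dihedral ij.
- have [E1 E2 E3] := cp x xn; have [c dc] := down_ex (sz [:: j]).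
  exists [::], i, (act j x), c; split=> //; first by rewrite E2.
  by move=> d; apply: word_braid2.
- have [E1 E2 E3] := bp x xn; have [_ F2 F3] := bp _ (sz [:: j]).
  have [c dc] := down_ex (sz [:: i; j]); rewrite /= in F2 F3.
  exists [:: i], j, (act i (act j x)), c; split=> //; last 2 first.
  + by lia.
  + by move=> d; apply: word_braid3.
  by apply: DownCons; rewrite ?size_act //; lia.
have [c dc] := down_ex (sz [:: j; i; j]).
exists [:: i; j], i, (act j (act i (act j x))), c; split=> //; last 2 first.
- case: dp => dp; have [_ E2 E3] := dp x xn; have [_ F2 F3] := dp _ (sz [:: j]);
    have [_ G2 G3] := dp _ (sz [:: i; j]); rewrite /= in F2 F3 G2 G3; lia.
- by move=> d; apply: word_braid4.
by case: dp => dp; have [_ E2 E3] := dp x xn; have [_ F2 F3] := dp _ (sz [:: j]);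
  rewrite /= in F2 F3; do 2! (apply: DownCons; rewrite ?size_act //; try lia).
Qed.

(* Two descents of the same point meet at the bottom of a dihedral orbit, where
   the braid relation compares the two words; a generator fixing a point slides
   down the dihedral orbit in the same way, until it is absorbed in [W_S]. *)
Lemma down_coset k x : (`|len x| < k)%N ->
  (forall a b, down x a -> down x b -> same_coset (word a) (word b)) /\
  (forall (i : I) a, aroot i x = 0 -> down x a ->
    same_coset (word (i :: a)) (word a)).
Proof.
elim: k x => // k IH x; rewrite ltnS => lk.
have lower (y : seq int) : len y < len x -> (`|len y| < k)%N by have := len_ge0 y; lia.
have step (i : I) : size x = n -> aroot i x < 0 -> len (act i x) < len x.
  move=> xn r; have [x0 ix] := act_size_ok i xn; have := act_down x0 ix r.
  by lia.
split.
- case=> [|i a] [|j b]; try by move=> *; apply: same_coset_refl.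
  + by move=> /down_len E /down_len; rewrite E.
  + by move=> /down_len E /down_len; rewrite E.
  move=> /down_inv [xn ri da] /down_inv [_ rj db].
  have [IHi _] := IH _ (lower _ (step _ xn ri)).
  have [IHj _] := IH _ (lower _ (step _ xn rj)).
  have [ij|ij] := eqVneq i j.
    by rewrite -ij in db *; apply/same_coset_cons/IHi.
  have [p [q [dp dq pq]]] := joint_descents xn ij ri rj.
  apply: same_coset_trans (same_coset_cons i (IHi _ _ da dp)) _.
  by rewrite pq; apply/same_coset_cons/IHj.
- move=> i [|j b] ri d.
    (* An empty path means that [x] is the origin, where the root of [s_0] equals 1; a generator
       with zero root there belongs to [S]. *)
    have E := down_acts d; rewrite /= in E; rewrite -E aroot_origin in ri.
    apply: same_coset_sym; exists [:: i]; last by rewrite invg1 mul1g.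
    by rewrite /= andbT; case: eqP ri => // /eqP.
  have [xn rj db] := down_inv d.
  have [IHj _] := IH _ (lower _ (step _ xn rj)).
  have [p [l [y [c [dpc dc rl lt_y pE]]]]] := sliding_generator xn ri rj.
  have [_ IHy] := IH _ (lower _ lt_y).
  have bpc := IHj _ _ db dpc.
  apply: same_coset_trans (same_coset_cons i (same_coset_cons j bpc)) _.
  rewrite pE; apply: same_coset_trans (same_coset_sym (same_coset_cons j bpc)).
  apply: same_coset_cons; rewrite !word_cat; apply: same_coset_mull.
  exact: IHy.
Qed.

(** Each added letter extends a descending path, cancels against a descent of the point, or fixes
    the point; the third case is where sliding is used. *)
Lemma same_coset_down a b : down (acts a origin) b -> same_coset (word a) (word b).
Proof.
elim: a b => [|i a IH] b; first by move/down_size0 ->; apply: same_coset_refl.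
have xn : size (acts a origin) = n by rewrite size_acts size_origin.
have [c dc] := down_ex xn; have ac := IH _ dc => db.
apply: same_coset_trans (same_coset_cons i ac) _; rewrite /= in db.
set x := acts a origin in xn dc db.
have [F G] := down_coset (ltnSn `|len x|).
have [F' _] := down_coset (ltnSn `|len (act i x)|).
have [r|r|r] := ltgtP 0 (aroot i x).
- apply: F' => //; apply: DownCons; rewrite ?size_act ?actK //.
  by rewrite aroot_actN //; lia.
- have := F _ _ dc (DownCons xn r db) => /(same_coset_cons i).
  by rewrite (word_cons _ i (i :: b)) (word_cons _ i b) gen_mulK.
have [x0 ix] := act_size_ok i xn; rewrite act_fix // in db.
by apply: same_coset_trans (G _ _ (esym r) dc) _; apply: F.
Qed.

Lemma same_coset_pt u v : pt u = pt v -> same_coset u v.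
Proof.
have [a <-] := cword_surj u; have [b <-] := cword_surj v; rewrite !pt_word => E.
have xn : size (acts a origin) = n by rewrite size_acts size_origin.
have [c dc] := down_ex xn; apply: same_coset_trans (same_coset_down dc) _.
by apply/same_coset_sym/same_coset_down; rewrite -E.
Qed.

(** [len] never exceeds the length of a group element, and a descending word attains it inside the
    same coset. *)
Lemma minrepsP w : minreps S w <-> len (pt w) = (clen w)%:Z.
Proof.
split=> [wS|wE v vS]; last first.
  by have := len_pt_le (w * v)%g; rewrite ptM_parabolic // wE.
apply/eqP; rewrite eq_le len_pt_le /=.
have [c dc] := down_ex (size_pt w).
have : same_coset w (word c) by apply: same_coset_pt; rewrite pt_word (down_acts dc).
move/wS; rewrite mulVKg (down_len dc) => /leq_trans/(_ (clen_word_le _ _)).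
by rewrite lez_nat.
Qed.

Lemma down_minreps x a : down x a -> minreps S (word a) /\ pt (word a) = x.
Proof.
move=> d; rewrite pt_word (down_acts d); split=> //; apply/minrepsP.
apply/eqP; rewrite eq_le len_pt_le pt_word (down_acts d) (down_len d) lez_nat.
exact: clen_word_le.
Qed.

Lemma minrep_ex x : size x = n -> exists2 w, minreps S w & pt w = x.
Proof. by case/down_ex=> a /down_minreps [aS aE]; exists (word a). Qed.

Lemma minreps_inj u v : minreps S u -> minreps S v -> pt u = pt v -> u = v.
Proof.
move=> uS vS uv; have uvS := same_coset_pt uv.
have := minreps_clenM uS uvS; rewrite mulVKg.
move/minrepsP: uS; move/minrepsP: vS; rewrite uv => -> [->] /eqP.
rewrite -[X in X == _]addn0 eqn_add2l eq_sym => /eqP /clen_eq0 E.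
by rewrite -[v](mulVKg u) E mulg1.
Qed.

(** * Segments and the segment decomposition *)

Local Notation s0 := (affC_s0 n).

Local Close Scope ring_scope.
Local Close Scope group_scope.
(** The letters of the longest segment from right to left, counted from 0: they run 0, 1, ..., n,
    n-1, ..., 1. *)
Definition seg_letter (j : nat) : nat := if j <= n then j else n.*2 - j.

Lemma segment_wordS j : j < n.*2 ->
  segment_word n j.+1 = seg_letter j :: segment_word n j.
Proof.
move=> j2; rewrite /segment_word /seg_letter ltnS; have [jn|jn] := leqP j n.
  by rewrite (leqW jn) -addn1 iotaD rev_cat.
(* The letters turn back after [j = n], but [segment_word] changes formula only beyond [n.+1]; the
   value [j = n.+1] straddles the two. *)
have [j1|j1] := leqP j n.+1.
  have -> : j = n.+1 by lia.
  have -> : n.+2 - n.+1 = 1%N by lia.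
  by have -> : (n.*2 - n.+2).+1 = n.*2 - n.+1 by lia.
have -> : j.+1 - n.+1 = (j - n.+1).+1 by lia.
by have -> : (n.*2 - j.+1).+1 = n.*2 - j by lia.
Qed.

Lemma seg_letter_le j : seg_letter j <= n.
Proof. by rewrite /seg_letter; case: (leqP j n); lia. Qed.

Lemma segmentS j : j < n.*2 ->
  segment n j.+1 = (gen (inord (seg_letter j)) * segment n j)%g.
Proof. by move=> j2; rewrite /segment segment_wordS // map_cons word_cons. Qed.

Lemma segment0 : segment n 0 = 1%g.
Proof. by rewrite /segment /segment_word. Qed.

Lemma segment_parabolic j : 0 < j <= n.*2 -> parabolic S (segment n j * s0)%g.
Proof.
case: j => // j; elim: j => [|j IH] /=  j2.
  rewrite segmentS ?segment0; last by lia.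
  have -> : inord (seg_letter 0) = ord0 :> I by apply: val_inj; rewrite /= inordK.
  by rewrite mulg1 /affC_s0 gen_mulgg; apply: parabolic1.
rewrite segmentS // -mulgA; apply: parabolicM; last by apply: IH; lia.
exists [:: inord (seg_letter j.+1)] => //=; rewrite andbT /affS.
rewrite -val_eqE /= inordK ?ltnS ?seg_letter_le //.
by rewrite /seg_letter; case: (leqP j.+1 n); lia.
Qed.

Local Open Scope ring_scope.

(** The unit entry travels right to the last position, changes sign there, and travels back: the
    j-th unit vector for 0 < j <= n, then minus the (2n-j+1)-th. *)
Definition seg_pt (j : nat) : seq int :=
  if j == 0%N then origin
  else if (j <= n)%N then nseq j.-1 0 ++ 1 :: nseq (n - j) 0
  else nseq (n.*2 - j) 0 ++ -1 :: nseq (j - n.+1) 0.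

Lemma size_seg_pt j : (j <= n.*2)%N -> size (seg_pt j) = n.
Proof.
move=> j2; rewrite /seg_pt; case: eqP => j0; first exact: size_origin.
by case: (leqP j n) => jn; rewrite size_cat /= !size_nseq; lia.
Qed.

Lemma seg_ptS j : (j < n.*2)%N ->
  act (seg_letter j) (seg_pt j) = seg_pt j.+1 /\ 0 < aroot (seg_letter j) (seg_pt j).
Proof.
move=> j2; rewrite /seg_letter /seg_pt /=; have [->|j0] := eqVneq j 0%N.
  by rewrite /origin; case: (n) hn => //= n' _; rewrite subr0 subn1.
have [jn|jn] := ltnP j n.
  rewrite (ltnW jn); have -> : (n - j = (n - j.+1).+1)%N by lia.
  rewrite act_swap ?aroot_swap ?size_nseq; try lia.
  by split=> //; rewrite cat_nseq_cons; case: j j0 {j2 jn}.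
have [jn'|jn'] := leqP j n.
  have -> : j = n by lia.
  rewrite subnn (_ : (n.*2 - n.+1 = n.-1)%N); last by lia.
  by rewrite act_opp ?aroot_opp ?size_nseq ?subnn //; lia.
have -> : (n.*2 - j = (n.*2 - j.+1) + 1)%N by lia.
rewrite nseqD -catA /=.
rewrite act_swap ?aroot_swap ?size_nseq; try lia.
split=> //; have -> : (j.+1 - n.+1 = (j - n.+1).+1)%N by lia.
by [].
Qed.

Lemma seg_ptP j : (j <= n.*2)%N ->
  pt (segment n j) = seg_pt j /\ len (seg_pt j) = j%:Z.
Proof.
elim: j => [|j IH] j2.
  by rewrite segment0 (pt_word [::]) /seg_pt /= len_origin.
have [E1 E2] := IH (ltnW j2); have [F1 F2] := seg_ptS j2.
have jn := size_seg_pt (ltnW j2).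
rewrite segmentS // ptM E1 cact_word // /= inordK ?ltnS ?seg_letter_le // F1.
split=> //; rewrite -F1 act_up ?E2 ?jn ?seg_letter_le //; lia.
Qed.

Lemma clen_segment_le j : (j <= n.*2)%N -> (clen (segment n j) <= j)%N.
Proof.
elim: j => [|j IH] j2; first by rewrite segment0 clen1.
rewrite segmentS //; apply: leq_trans (clenM _ _) _.
rewrite -(add1n j); apply: leq_add; last exact/IH/ltnW.
exact: (clen_word_le _ [:: _]).
Qed.

Lemma segment_minreps j : (j <= n.*2)%N -> minreps S (segment n j).
Proof.
move=> j2; have [E1 E2] := seg_ptP j2; apply/minrepsP.
apply/eqP; rewrite eq_le len_pt_le //= E1 E2 lez_nat.
exact: clen_segment_le.
Qed.

Lemma clen_segment j : (j <= n.*2)%N -> clen (segment n j) = j.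
Proof.
move=> j2; have /minrepsP := segment_minreps j2.
by have [-> ->] := seg_ptP j2 => -[].
Qed.

Lemma abs_sum_seg_pt x : size x = n -> abs_sum x = 1 ->
  exists2 j, (0 < j <= n.*2)%N & x = seg_pt j.
Proof.
move=> xn /abs_sum1 [p [c [q [xE cE]]]]; move: xn.
rewrite xE size_cat /= !size_nseq => pq.
case: cE => ->; [exists p.+1 | exists (n.*2 - p)%N]; try lia.
  have pn : (p < n)%N by lia.
  by rewrite /seg_pt /= pn (_ : (n - p.+1 = q)%N); last lia.
rewrite /seg_pt (_ : (n.*2 - p == 0)%N = false); last lia.
rewrite (_ : (n.*2 - p <= n)%N = false); last lia.
by congr (nseq _ _ ++ _ :: nseq _ _); lia.
Qed.

Lemma abs_sum_acts a x : all S a -> abs_sum (acts a x) = abs_sum x.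
Proof.
elim: a => //= i a IH /andP [iS /IH <-].
case: i iS => [[|k] ki] //= _; exact: abs_sum_act.
Qed.

(** [s_0] sends the origin to (1,0,...,0) and [v] acts by a signed permutation, so the image is one
    of the 2n signed unit vectors, each of which is the point of one segment. *)
Lemma parabolic_s0 v : parabolic S v -> minreps S (v * s0)%g ->
  exists2 j, (0 < j <= n.*2)%N & (v * s0)%g = segment n j.
Proof.
move=> vS vsS; have n2 : (1 <= n.*2)%N by lia.
have s0E : s0 = segment n 1.
  rewrite segmentS // segment0 mulg1; congr cgen.
  by apply: val_inj; rewrite /= inordK.
have [||j j2 E] := @abs_sum_seg_pt (pt (v * s0)%g).
  by rewrite size_pt.
  rewrite ptM s0E; have [-> _] := seg_ptP n2.
  case: vS => a aS <-; rewrite cact_word ?size_seg_pt // abs_sum_acts //.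
  rewrite /seg_pt /= (ltnW hn) /abs_sum big_cons big_seq big1 // => b.
  by move=> /nseqP [->].
exists j => //; have /andP [_ j2'] := j2.
apply: minreps_inj => //; first exact: segment_minreps.
by have [-> _] := seg_ptP j2'.
Qed.

Lemma segment_decomp_minreps (w : W) lam : segment_decomp w lam -> minreps S w.
Proof. by case=> // v _; rewrite clen1. Qed.

Lemma segment_decompP (w : W) j lam : segment_decomp w (j :: lam) ->
  exists u : W, [/\ (0 < j <= n.*2)%N, segment_decomp u lam & w = (u * segment n j)%g].
Proof.
move=> d; inversion d as [|w' u v j' lam' wS w1 uS vS wE lE j2 vE du]; subst.
exists u; split=> //; rewrite -vE mulgA -wE -mulgA.
by rewrite /affC_s0 gen_mulgg mulg1.
Qed.

Lemma segment_decomp_inj (w : W) lam mu :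
  segment_decomp w lam -> segment_decomp w mu -> lam = mu.
Proof.
move=> d; elim: d mu => {w lam} [|w u v j lam wS w1 uS vS wE lE j2 vE du IH] mu.
  by move=> d; inversion d.
move=> d; inversion d as [E1 E2|w' u' v' j' lam' _ _ uS' vS' wE' lE' j2' vE' du'];
  subst; first by case: w1.
have uu' : u = u'.
  apply: minreps_inj => //.
  by rewrite -(ptM_parabolic u vS) -(ptM_parabolic u' vS') -wE wE'.
have vv' : v = v' by apply: (mulgI u); rewrite -wE wE' uu'.
congr (_ :: _); last by apply: IH; rewrite uu'.
have /andP [_ /clen_segment E1] := j2; have /andP [_ /clen_segment E2] := j2'.
by rewrite -E1 -E2 -vE -vE' vv'.
Qed.

Lemma segment_decomp_ex w : minreps S w -> exists lam, segment_decomp w lam.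
Proof.
have [k] := ubnP (clen w); elim: k w => // k IH w; rewrite ltnS => wk wS.
have [->|w1] := pselect (w = 1%g); first by exists [::]; apply: SegDecomp1.
have [u uS uE] := minrep_ex (size_pt (w * s0)%g).
have [v vS wE] : exists2 v : W, parabolic S v & (w * s0 = u * v)%g.
  exists (u^-1 * (w * s0))%g; first exact: (same_coset_pt uE).
  by rewrite mulVKg.
have lE : clen (w * s0)%g = (clen u + clen v)%N.
  by rewrite wE (minreps_clenM uS vS).
have wE' : w = (u * (v * s0))%g.
  by rewrite mulgA -wE -mulgA /affC_s0 gen_mulgg mulg1.
(* A shortest word of [w] must end in [s_0]: any other last letter could be dropped within the
   coset, against minimality. *)
have lt_w : (clen (w * s0)%g < clen w)%N.
  have [a aw aE] := clen_word w; case/lastP: a aw aE => [|a i] aw aE.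
    by case: w1; rewrite -aE.
  have wi : (w * gen i)%g = word a.
    by rewrite -aE -cats1 word_cat -mulgA gen_mulgg mulg1.
  have lt_i : (clen (w * gen i)%g < clen w)%N.
    by rewrite wi -aw size_rcons ltnS clen_word_le.
  have [i0|i0] := eqVneq i ord0; first by rewrite /affC_s0 -i0.
  have /wS : parabolic S (gen i) by exists [:: i]; rewrite //= /affS i0.
  by rewrite leqNgt lt_i.
(* An element of the coset of [v * s0] shorter than [v * s0] would, after multiplication by [u],
   give an element of the coset of [w] shorter than [w]. *)
have vsS : minreps S (v * s0)%g.
  move=> z zS; rewrite leqNgt; apply/negP => lt_z.
  have := wS z zS; rewrite leqNgt => /negP; apply.
  have -> : (w * z = u * (v * s0 * z))%g by rewrite {1}wE' -!mulgA.
  apply: leq_ltn_trans (clenM _ _) _; apply: leq_trans lt_w; rewrite lE -addnS.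
  by rewrite -addnS leq_add2l; apply: leq_trans lt_z (clen_mul_gen v ord0).
have [j j2 vE] := parabolic_s0 vS vsS.
have [|lam dlam] := IH u _ uS; first by lia.
by exists (j :: lam); apply: (SegDecompS (u := u) (v := v)).
Qed.

Lemma seg_partP w : minreps S w -> segment_decomp w (seg_part w).
Proof. by move/segment_decomp_ex => ex; apply: (xgetPex [::] ex). Qed.

Lemma seg_part_eq (w : W) lam : segment_decomp w lam -> seg_part w = lam.
Proof.
move=> d; apply: segment_decomp_inj (d).
exact/seg_partP/segment_decomp_minreps/d.
Qed.

Lemma segment_decomp_segment j : (j <= n.*2)%N ->
  segment_decomp (segment n j) (one_row j).
Proof.
rewrite /one_row; case: j => [|j] j2.
  by rewrite segment0; apply: SegDecomp1.
apply: (@SegDecompS n _ 1%g (segment n j.+1 * s0)%g) => //.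
- exact: segment_minreps.
- by move=> E; have := clen_segment j2; rewrite E clen1.
- by move=> z _; rewrite clen1.
- exact: segment_parabolic.
- by rewrite mul1g.
- by rewrite clen1.
- by rewrite -mulgA /affC_s0 gen_mulgg mulg1.
exact: SegDecomp1.
Qed.

Lemma seg_part_one_row w j : minreps S w -> (j <= n.*2)%N ->
  seg_part w = one_row j <-> pt w = seg_pt j.
Proof.
move=> wS j2; have [E _] := seg_ptP j2; split=> [wE|wE].
  have := seg_partP wS; rewrite wE -E; case: (j) => [|k] /=.
    by move=> d; inversion d; rewrite segment0.
  move/segment_decompP=> [u [_ d ->]]; inversion d.
  by rewrite mul1g.
have -> : w = segment n j.
  by apply: minreps_inj => //; [exact: segment_minreps | rewrite E].
exact/seg_part_eq/segment_decomp_segment.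
Qed.

(** * Staircases and 0/1 points *)

Fixpoint stair (k : nat) : W :=
  if k is k'.+1 then (stair k' * segment n k)%g else 1%g.

Definition stair_pt (k : nat) : seq int := nseq k 1 ++ nseq (n - k) 0.

(** [s_0] turns the first entry [a] into [1 - a], and the remaining letters carry it past the next
    [j] entries. *)
Lemma cact_segment j a s : (j < n)%N -> size s = n.-1 ->
  cact (segment n j.+1) (a :: s) = take j s ++ (1 - a) :: drop j s.
Proof.
move=> jn sn; have asn : size (a :: s) = n by rewrite /= sn; lia.
elim: j jn => [|j IH] jn.
  rewrite segmentS ?segment0 ?mulg1; last by lia.
  by rewrite cact_word //= inordK // take0 drop0.
rewrite segmentS ?cactM ?IH //; try lia.
have js : (j < size s)%N by lia.
rewrite (take_nth 0 js) (drop_nth 0 js) cat_rcons cact_word; last first.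
  by rewrite size_cat /= size_takel ?size_drop; lia.
rewrite -[LHS]/(act (inord (seg_letter j.+1) : I) _).
rewrite inordK ?ltnS ?seg_letter_le // /seg_letter (ltnW jn).
by rewrite act_swap // size_takel; lia.
Qed.

Lemma cact_stair k t : (k <= n)%N -> size t = (n - k)%N ->
  cact (stair k) (nseq k 0 ++ t) = nseq k 1 ++ t.
Proof.
elim: k t => [|k IH] t kn tn.
  by rewrite subn0 in tn; rewrite /= -[1%g]/(word [::]) cact_word.
have tn' : (size (nseq k (0 : int) ++ t) = n.-1)%N.
  by rewrite size_cat size_nseq tn; lia.
rewrite /= cactM; last by rewrite /= tn'; lia.
rewrite cact_segment // take_size_cat ?drop_size_cat ?size_nseq // subr0.
by rewrite IH ?cat_nseq_cons //= ?tn; lia.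
Qed.

Lemma pt_stair k : (k <= n)%N -> pt (stair k) = stair_pt k.
Proof.
move=> kn; rewrite /pt /origin.
have -> : nseq n (0 : int) = nseq k 0 ++ nseq (n - k) 0.
  by rewrite -nseqD subnKC.
by rewrite cact_stair // size_nseq.
Qed.

Definition bits (bs : seq bool) : seq int := [seq (nat_of_bool b)%:Z | b <- bs].

(* The sum of the positions, counted from 1, of the [true] entries. *)
Fixpoint weight (bs : seq bool) : nat :=
  if bs is b :: bs' then (b + count id bs' + weight bs')%N else 0%N.

(** For bits b, c in this order [pair_len] equals c, and a bit alone contributes itself; an entry 1
    in position p therefore accounts for p walls. *)
Lemma len_bits bs : len (bits bs) = (weight bs)%:Z.
Proof.
elim: bs => //= b bs ->.
have -> : row_len b%:Z (bits bs) = (count id bs)%:Z.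
  elim: bs => [|c bs IH] /=; first by rewrite /row_len big_nil.
  rewrite row_len_cons.
  have -> : pair_len b%:Z c%:Z = c%:Z by case: (b); case: c.
  by rewrite IH PoszD.
have -> : crossings (b%:Z *+ 2) = b%:Z by case: b.
by rewrite !PoszD.
Qed.

Lemma weight_negb bs :
  (weight [seq ~~ b | b <- bs] + weight bs)%N = weight (nseq (size bs) true).
Proof.
elim: bs => //= b bs IH; have := count_predC id bs.
rewrite count_map count_nseq /= -IH.
have -> : count (preim negb id) bs = count (predC id) bs by apply: eq_count.
by case: b => /=; lia.
Qed.

Lemma weight_cat_false bs q : weight (bs ++ nseq q false) = weight bs.
Proof.
elim: bs => [|b bs IH] /=; last by rewrite IH count_cat count_nseq mul0n addn0.
by elim: q => //= q ->; rewrite count_nseq.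
Qed.

Lemma weightS k : weight (nseq k.+1 true) = (weight (nseq k true) + k.+1)%N.
Proof. by rewrite /= count_nseq /=; lia. Qed.

Definition bits_pt (k : nat) (bs : seq bool) : seq int :=
  bits (bs ++ nseq (n - k) false).

Lemma len_bits_pt k bs : len (bits_pt k bs) = (weight bs)%:Z.
Proof. by rewrite len_bits weight_cat_false. Qed.

Lemma stair_ptE k : stair_pt k = bits_pt k (nseq k true).
Proof. by rewrite /bits_pt /bits map_cat !map_nseq. Qed.

Lemma clen_stair_le k : (k <= n)%N -> (clen (stair k) <= weight (nseq k true))%N.
Proof.
elim: k => [|k IH] kn; first by rewrite /= clen1.
rewrite weightS; apply: leq_trans (clenM _ _) _.
by apply: leq_add; [apply/IH/ltnW | apply: clen_segment_le; lia].
Qed.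

Lemma stair_minreps k : (k <= n)%N -> minreps S (stair k).
Proof.
move=> kn; apply/minrepsP; apply/eqP; rewrite eq_le len_pt_le /=.
by rewrite pt_stair // stair_ptE len_bits_pt lez_nat clen_stair_le.
Qed.

Lemma clen_stair k : (k <= n)%N -> clen (stair k) = weight (nseq k true).
Proof.
move=> kn; have /minrepsP := stair_minreps kn.
by rewrite pt_stair // stair_ptE len_bits_pt => -[].
Qed.

Lemma segment_decomp_stair k : (k <= n)%N -> segment_decomp (stair k) (staircase k).
Proof.
elim: k => [|k IH] kn; first exact: SegDecomp1.
have -> : staircase k.+1 = k.+1 :: staircase k.
  by rewrite /staircase -[in iota 1 k.+1](addn1 k) iotaD rev_cat add1n.
have k2 : (0 < k.+1 <= n.*2)%N by lia.
apply: (@SegDecompS n _ (stair k) (segment n k.+1 * s0)%g) => //.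
- exact: stair_minreps.
- move=> E; have := clen_stair kn; rewrite E clen1 weightS; lia.
- exact/stair_minreps/ltnW.
- exact: segment_parabolic.
- by rewrite mulgA.
- rewrite [stair k.+1]/= -mulgA; apply: (@minreps_clenM _ _ S).
    exact/stair_minreps/ltnW.
  exact: segment_parabolic.
- by rewrite -mulgA /affC_s0 gen_mulgg mulg1.
exact/IH/ltnW.
Qed.

Lemma segment_decomp_prod (w w' : W) lam :
  segment_decomp w lam -> segment_decomp w' lam -> w = w'.
Proof.
move=> d; elim: d w' => {w lam} [|w u v j lam wS w1 uS vS wE lE j2 vE du IH] w'.
  by move=> d; inversion d.
move/segment_decompP=> [u' [_ /IH <- ->]]; rewrite -vE mulgA -wE -mulgA.
by rewrite /affC_s0 gen_mulgg mulg1.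
Qed.

Lemma seg_part_staircase w k : minreps S w -> (k <= n)%N ->
  seg_part w = staircase k <-> pt w = stair_pt k.
Proof.
move=> wS kn; rewrite -pt_stair //; split=> [wE|wE].
  have := seg_partP wS; rewrite wE => d.
  by rewrite (segment_decomp_prod d (segment_decomp_stair kn)).
rewrite (minreps_inj wS (stair_minreps kn) wE).
exact/seg_part_eq/segment_decomp_stair.
Qed.

(** * From covers in the lattice to Bruhat order *)

Lemma refl_pair_cact x y : refl_pair x y -> size x = n ->
  exists2 t : W, reflections t & cact t x = y.
Proof.
elim=> {x y} [i x ix|i x y ix _ IH] xn.
  exists (gen (inord i)); last by rewrite cact_word //= inordK // ltnS -xn.
  by exists 1%g, (inord i); rewrite invg1 mul1g mulg1.
have [|t rt tE] := IH; first by rewrite size_act.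
have iE : (inord i : I) = i :> nat by rewrite inordK // ltnS -xn.
exists (gen (inord i) * t * (gen (inord i))^-1)%g; first exact: reflection_conj.
have gE z : size z = n -> cact (gen (inord i)) z = act i z.
  by move=> zn; rewrite cact_word //= iE.
rewrite gen_inv cactM // cactM ?size_cact // (gE x) // tE gE ?actK //.
by rewrite -tE size_cact size_act.
Qed.

(* If [t * w] were longer than [w], the exchange condition would write [w] as a
   word of the coset of [t * w] with a letter deleted. *)
Lemma minreps_reflection w t : minreps S w -> reflections t ->
  len (pt w) = len (pt (t * w)%g) + 1 -> minreps S (t * w)%g /\ bruhat (t * w)%g w.
Proof.
move=> wS rt lt_t; have tt : (t * t = 1)%g.
  case: (rt) => x [i ->].
  by rewrite -!mulgA mulKg (mulgA (gen i)) gen_mulgg mul1g mulgV.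
have wE := (minrepsP w).1 wS.
have lt_tw : (clen (t * w)%g < clen w)%N.
  rewrite ltnNge; apply/negP => le_tw.
  have [v vS vE] := minrep_ex (size_pt (t * w)%g).
  have := (minrepsP v).1 vS; rewrite vE => vlen.
  have [b bS bE] := same_coset_pt vE.
  have [a aS aE] := clen_word v.
  have abE : word (a ++ b) = (t * w)%g by rewrite word_cat aE bE mulVKg.
  have := @strong_exchange _ _ (a ++ b) t rt; rewrite abE mulgA tt mul1g.
  case/(_ le_tw) => p [i [q [abE' wpq]]].
  case: (cat_eq_cat_cons abE') => [[e [ae qe]]|[e [pe be]]].
    have := wS (word b)^-1%g; have bS' : parabolic S (word b) by exists b.
    rewrite {2}wpq qe catA word_cat mulgK => /(_ (parabolicV bS')).
    move/leq_trans/(_ (clen_word_le _ _)); move: aS.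
    by rewrite ae !size_cat /=; lia.
  have : pt w = pt v.
    rewrite wpq pe -catA word_cat aE; apply: ptM_parabolic.
    exists (e ++ q) => //; move: bS; rewrite be !all_cat /=.
    by case/and3P=> -> _ ->.
  by rewrite vE; move=> E; move: lt_t; rewrite E; lia.
split.
  apply/minrepsP; apply/eqP; rewrite eq_le len_pt_le /=.
  by rewrite wE in lt_t; lia.
have E : (t * w * (w^-1 * t * w) = w)%g by rewrite !mulgA mulgK tt mul1g.
apply: (@BruhatStep _ _ _ (w^-1 * t * w)%g); rewrite ?E //; last exact: BruhatRefl.
by have := reflection_conj w^-1%g rt; rewrite invgK.
Qed.

Definition lower_pt (w : W) (y : seq int) : Prop :=
  exists2 v, lower_minreps S w v & pt v = y.

Lemma lower_pt_cover w x y : lower_pt w x -> rcover x y -> lower_pt w y.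
Proof.
case=> v [vS vw] vx [xy lxy]; have xn : size x = n by rewrite -vx size_pt.
have [t rt tE] := refl_pair_cact xy xn.
have ptE : pt (t * v)%g = y by rewrite ptM vx.
have [|tS tv] := minreps_reflection vS rt; first by rewrite ptE vx.
exists (t * v)%g => //; split=> //.
exact: bruhat_trans tv vw.
Qed.

Lemma lower_pt_self w : minreps S w -> lower_pt w (pt w).
Proof. by move=> wS; exists w => //; split=> //; apply: BruhatRefl. Qed.

Lemma pt_rank1 w : minreps S w -> clen w = 1 -> pt w = seg_pt 1.
Proof.
move=> /minrepsP + w1; rewrite w1; have [a] := clen_word w; rewrite w1.
case: a => [|i [|//]] // _ <-; rewrite pt_word /=.
have [i0|i0] := eqVneq i ord0; last by rewrite act_origin // len_origin.
have n2 : (0 < n.*2)%N by lia.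
by have [<- _] := seg_ptS n2; rewrite i0.
Qed.

(** From (1,0,...,0) the generator [s_0] returns to the origin, [s_1] moves the 1 to the second
    place, and all others fix the point. *)
Lemma pt_rank2 w : minreps S w -> clen w = 2 -> pt w = seg_pt 2.
Proof.
move=> /minrepsP + w2; rewrite w2; have [a] := clen_word w; rewrite w2.
case: a => [|i [|j [|//]]] // _ <-; rewrite pt_word /=.
have [j0|j0] := eqVneq j ord0; last first.
  by rewrite act_origin //; have := @len_acts_le [:: i] => /= ? ?; lia.
have n2 : (0 < n.*2)%N by lia.
have n3 : (1 < n.*2)%N by lia.
have -> : act j origin = seg_pt 1 by have [<- _] := seg_ptS n2; rewrite j0.
have [E1 E2] := seg_ptS n3; have [_ l1] := seg_ptP (ltnW n3).
have [i1|i1] := eqVneq (i : nat) 1%N.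
  by move=> _; rewrite i1 -E1 /seg_letter (ltnW hn).
have sz1 := size_seg_pt (ltnW n3); have [x0 ix] := act_size_ok i sz1.
have [r|r] := ltP 0 (aroot i (seg_pt 1)); last first.
  have [r0|r0] := eqVneq (aroot i (seg_pt 1)) 0.
    by rewrite act_fix // l1.
  have r1 : aroot i (seg_pt 1) < 0 by rewrite lt_neqAle r0.
  by have := act_down x0 ix r1; rewrite l1; lia.
move: r; rewrite /seg_pt /= (ltnW hn); case: i {x0 ix} i1 => [[|[|k]] ki] //= _.
by rewrite lin_root_nseq0.
Qed.

Lemma not_palindromic_of_two w y1 y2 i : (0 < i <= 2)%N -> minreps S w ->
  lower_pt w y1 -> lower_pt w y2 -> y1 <> y2 ->
  len (pt w) = len y1 + i%:Z -> len (pt w) = len y2 + i%:Z ->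
  ~ palindromic S w.
Proof.
move=> i2 wS [v1 v1w v1E] [v2 v2w v2E] y12 l1 l2.
have wE := (minrepsP w).1 wS.
have c1 : clen v1 = (clen w - i)%N.
  by have := (minrepsP v1).1 v1w.1; rewrite v1E; lia.
have c2 : clen v2 = (clen w - i)%N.
  by have := (minrepsP v2).1 v2w.1; rewrite v2E; lia.
have v12 : v1 <> v2 by move=> E; apply: y12; rewrite -v1E -v2E E.
have iw : (i <= clen w)%N by have := len_ge0 y1; lia.
move=> /(_ i iw) E; have := coef_poincare_ge2 v1w v2w v12 c1 c2; rewrite -E.
apply/negP; rewrite -ltNge; apply: le_lt_trans (coef_poincare_le1 _ _) _ => //.
move=> u v uS vS uc vc; apply: minreps_inj => //; move: uc vc.
have [->|->] : i = 1%N \/ i = 2%N by lia.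
  by move=> /pt_rank1 -> // /pt_rank1 ->.
by move=> /pt_rank2 -> // /pt_rank2 ->.
Qed.

Lemma branching_not_palindromic w : minreps S w -> branching (pt w) ->
  ~ palindromic S w.
Proof.
move=> wS; have self := lower_pt_self wS.
case=> [[y1 [y2 [y12 c1 c2]]]|[y cy [y1 [y2 [y12 c1 c2]]]]].
  apply: (@not_palindromic_of_two w y1 y2 1) => //; try exact: lower_pt_cover self _.
    by case: c1.
  by case: c2.
have yw := lower_pt_cover self cy.
apply: (@not_palindromic_of_two w y1 y2 2) => //; try exact: lower_pt_cover yw _.
  by have := c1.2; have := cy.2; lia.
by have := c2.2; have := cy.2; lia.
Qed.

(** * Lower ideals of segments and staircases *)

Lemma bruhat_clen (u w : W) : bruhat u w -> (clen u <= clen w)%N.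
Proof. by elim=> // {}u t {}w _ lt_u _; apply: leq_trans (ltnW lt_u). Qed.

Lemma rcover_seg_pt j : (j < n.*2)%N -> rcover (seg_pt j.+1) (seg_pt j).
Proof.
move=> j2; have [E r] := seg_ptS j2; have jn := size_seg_pt (ltnW j2).
rewrite -E -{2}(actK (seg_letter j) (seg_pt j)).
apply: rcover_act; rewrite ?size_act ?jn ?seg_letter_le //; first lia.
by rewrite aroot_act ?jn ?seg_letter_le //; lia.
Qed.

Lemma lower_segment j v : (j <= n.*2)%N ->
  lower_minreps S (segment n j) v <-> exists i : 'I_j.+1, segment n i = v.
Proof.
move=> j2; split=> [[vS vw]|[i <-]].
  suff [i i2 vi] : exists2 i, (i <= n.*2)%N & pt v = seg_pt i.
    have vE : v = segment n i.
      by apply: minreps_inj (segment_minreps i2) _ => //; have [-> _] := seg_ptP i2.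
    have ij : (i < j.+1)%N by have := bruhat_clen vw; rewrite vE !clen_segment.
    by exists (Ordinal ij).
  have [j0|j0] := posnP j.
    exists 0%N => //; have := bruhat_clen vw; rewrite clen_segment // j0 leqn0.
    by move=> /eqP /clen_eq0 ->; rewrite (pt_word [::]).
  have [a aS aE] : parabolic S (segment n j * s0)%g.
    by apply: segment_parabolic; rewrite j0.
  have waE : word (a ++ [:: ord0]) = segment n j.
    by rewrite word_cat aE -mulgA gen_mulgg mulg1.
  have [b /subseqP [mk mks bE] bv] := bruhat_subword vw waE.
  rewrite -bv bE pt_word -(cat_take_drop (size a) mk) mask_cat; last first.
    by rewrite size_takel // mks size_cat leq_addr.
  set b1 := mask _ a; have b1S : all S b1.
    by apply/allP => i /mem_mask; apply: (allP aS).
  rewrite acts_cat; set b2 := mask _ _.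
  (* The subword either drops the only [s_0], and the point is the origin, or keeps it, and the
     point is a signed unit vector. *)
  have [->|->] : b2 = [::] \/ b2 = [:: ord0].
    rewrite /b2; case: (drop _ mk) => [|[] mk'] /=; [by left|right|left].
      by case: mk'.
    by case: mk'.
  - exists 0%N => //; rewrite -[acts b1 _]pt_word; apply: cact_parabolic.
    by exists b1.
  have n2 : (0 < n.*2)%N by lia.
  have -> : acts [:: ord0] origin = seg_pt 1 by have [<- _] := seg_ptS n2.
  have [||i /andP [_ i2] iE] := @abs_sum_seg_pt (acts b1 (seg_pt 1)).
  - by rewrite size_acts size_seg_pt.
  - rewrite abs_sum_acts // /seg_pt /= (ltnW hn) /abs_sum big_cons big_seq big1 //.
    by move=> c /nseqP [->].
  by exists i.
have /(_ i) low : forall i, (i <= j)%N -> lower_pt (segment n j) (seg_pt i).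
  move=> k kj; rewrite -(subKn kj); have: (j - k <= j)%N := leq_subr _ _.
  elim: (j - k)%N => [|d IH] dj.
    by rewrite subn0; have [<- _] := seg_ptP j2; apply/lower_pt_self/segment_minreps.
  apply: lower_pt_cover (IH (ltnW dj)) _.
  have -> : (j - d = (j - d.+1).+1)%N by lia.
  by apply: rcover_seg_pt; lia.
have ij : (i <= j)%N by rewrite -ltnS.
have i2 := leq_trans ij j2; have [u uw uE] := low ij.
have <- // : u = segment n i.
apply: minreps_inj (segment_minreps i2) _; first by case: uw.
by have [-> _] := seg_ptP i2.
Qed.

Lemma palindromic_segment j : (j <= n.*2)%N -> palindromic S (segment n j).
Proof.
move=> j2; have i2 (i : 'I_j.+1) : (i <= n.*2)%N.
  by apply: leq_trans j2; rewrite -ltnS.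
apply: (palindromic_enum (F := fun i : 'I_j.+1 => segment n i) (r := @rev_ord _)).
- by move=> v; apply: lower_segment.
- move=> i i' E; apply: val_inj; rewrite /= -(clen_segment (i2 i)) E.
  exact/clen_segment/i2.
- exact: rev_ordK.
by move=> i; rewrite !clen_segment //=; have := ltn_ord i; lia.
Qed.

Lemma size_bits_pt k bs : (k <= n)%N -> size bs = k -> size (bits_pt k bs) = n.
Proof. by move=> kn bk; rewrite size_map size_cat size_nseq bk; lia. Qed.

(** A letter below [k] flips the first bit or exchanges two neighbours among the first [k]; the sign
    change of the last entry has a larger index and cannot occur. *)
Lemma act_bits_pt k bs (i : nat) : (i < k)%N -> size bs = k ->
  exists2 bs', size bs' = k & act i (bits_pt k bs) = bits_pt k bs'.
Proof.
case: i => [|i] ik bk.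
  case: bs bk => [|b bs] bk; first by rewrite -bk in ik.
  by exists (~~ b :: bs) => //; rewrite /bits_pt /=; case: b {bk}.
exists (take i bs ++ nth false bs i.+1 :: nth false bs i :: drop i.+2 bs).
  by rewrite size_cat /= size_takel ?size_drop ?bk; lia.
have bE : bs = take i bs ++ nth false bs i :: nth false bs i.+1 :: drop i.+2 bs.
  by rewrite -!drop_nth ?cat_take_drop // bk // ltnW.
have E c d : bits_pt k (take i bs ++ c :: d :: drop i.+2 bs) =
    bits (take i bs) ++ (nat_of_bool c)%:Z :: (nat_of_bool d)%:Z ::
      bits (drop i.+2 bs ++ nseq (n - k) false).
  by rewrite /bits_pt /bits -catA map_cat.
rewrite {1}bE !E act_swap //.
by rewrite size_map size_takel // bk; lia.
Qed.

Lemma stair_word k : (k <= n)%N ->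
  exists2 a, all (fun i : I => (i < k)%N) a & word a = stair k.
Proof.
elim: k => [|k IH] kn; first by exists [::].
have [a aS aE] := IH (ltnW kn).
exists (a ++ [seq inord i | i <- segment_word n k.+1]); last by rewrite word_cat aE.
rewrite all_cat; apply/andP; split.
  by apply: sub_all aS => i /= /ltnW.
apply/allP => _ /mapP [i + ->]; rewrite /segment_word ltnS (ltnW kn).
by rewrite mem_rev mem_iota /= add0n => ik; rewrite inordK //; lia.
Qed.

Lemma all_true_or_false bs :
  bs = nseq (size bs) true \/ exists r t, bs = nseq r true ++ false :: t.
Proof.
elim: bs => [|b bs IH]; first by left.
case: b; last by right; exists 0%N, bs.
case: IH => [E|[r [t E]]]; first by left; rewrite {1}E.
by right; exists r.+1, t; rewrite E.
Qed.

Lemma lower_bits_pt k bs : (k <= n)%N -> size bs = k ->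
  lower_pt (stair k) (bits_pt k bs).
Proof.
move=> kn; have [d] := ubnP (weight (nseq k true) - weight bs)%N.
elim: d bs => // d IH bs bd bk.
have [E|[r [t bsE]]] := all_true_or_false bs.
  rewrite E bk -stair_ptE -pt_stair //.
  exact/lower_pt_self/stair_minreps.
(* Climbing one step: a leading 0 is raised to 1, and otherwise the last 1 of the initial run moves
   one place to the right. Both add 1 to the weight, and a simple descent undoes them. *)
suff [bs' bs'k c] : exists2 bs', size bs' = k & rcover (bits_pt k bs') (bits_pt k bs).
  apply: (lower_pt_cover _ c); apply: IH => //.
  have := c.2; rewrite !len_bits_pt.
  by have := weight_negb bs'; rewrite bs'k; lia.
case: r bsE => [|r] bsE.
  exists (true :: t); first by rewrite -bk bsE.
  by rewrite bsE; apply: (@rcover_head 1).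
exists (nseq r true ++ false :: true :: t).
  by rewrite -bk bsE !size_cat !size_nseq /= !addnS.
rewrite bsE nseq_rcons /bits_pt /bits -!catA !map_cat.
exact: rcover_swap.
Qed.

Lemma lower_stair k v : (k <= n)%N -> lower_minreps S (stair k) v ->
  exists2 bs, size bs = k & pt v = bits_pt k bs.
Proof.
move=> kn [vS vw]; have [a aS aE] := stair_word kn.
have [b ba <-] := bruhat_subword vw aE; rewrite pt_word.
have {ba} : all (fun i : I => (i < k)%N) b.
  by apply/allP => i /(mem_subseq ba); apply: (allP aS).
elim: b => [|i b IH] /=.
  exists (nseq k false); first exact: size_nseq.
  by rewrite /bits_pt -nseqD subnKC // /bits map_nseq.
by case/andP=> ik /IH [bs bk ->]; apply: act_bits_pt.
Qed.

Definition minrep (x : seq int) : W :=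
  xget 1%g [set w : W | minreps S w /\ pt w = x].

Lemma minrepP x : size x = n -> minreps S (minrep x) /\ pt (minrep x) = x.
Proof.
move=> xn; apply: (@xgetPex _ 1%g [set w : W | minreps S w /\ pt w = x]).
by have [w wS wx] := minrep_ex xn; exists w.
Qed.

Lemma palindromic_stair k : (k <= n)%N -> palindromic S (stair k).
Proof.
move=> kn; pose F (t : k.-tuple bool) := minrep (bits_pt k t).
have FP (t : k.-tuple bool) : minreps S (F t) /\ pt (F t) = bits_pt k t.
  by apply: minrepP; apply: size_bits_pt; rewrite ?size_tuple.
have clenF t : clen (F t) = weight t.
  by have [/minrepsP E ptE] := FP t; move: E; rewrite ptE len_bits_pt => -[].
apply: (palindromic_enum (F := F) (r := fun t => [tuple of [seq ~~ b | b <- t]])).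
- move=> v; split=> [vw|[t <-]].
    have [bs bk vE] := lower_stair kn vw.
    exists (tcast bk (in_tuple bs)); have [FS FE] := FP (tcast bk (in_tuple bs)).
    apply: minreps_inj => //; first by case: vw.
    by rewrite FE vE val_tcast.
  have [FS FE] := FP t; have [u uw uE] := lower_bits_pt kn (size_tuple t).
  by have <- // : u = F t; apply: minreps_inj; rewrite ?FE //; case: uw.
- move=> t t' E; have [_ E1] := FP t; have [_ E2] := FP t'.
  have : bits_pt k t = bits_pt k t' by rewrite -E1 -E2 E.
  rewrite /bits_pt /bits !map_cat => /eqP; rewrite eqseq_cat ?size_map ?size_tuple //.
  by rewrite eqxx andbT => /eqP /inj_map tt'; apply/val_inj/tt' => -[] [].
- move=> t; apply: val_inj; rewrite /= -map_comp map_id_in // => b _ /=.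
  exact: negbK.
by move=> t; rewrite !clenF clen_stair //= weight_negb size_tuple.
Qed.

Lemma seg_pt1 : seg_pt 1 = stair_pt 1.
Proof. by rewrite /seg_pt /= (ltnW hn). Qed.

End Action.

Theorem theorem6p9 (n : nat) (w : affC n) (hn : 2 <= n)
    (hw : minreps (@affS n) w) :
  palindromic (@affS n) w <->
    (exists2 j : nat, 0 <= j <= n.*2 & seg_part w = one_row j) \/
    (exists2 k : nat, 1 < k <= n & seg_part w = staircase k).
Proof.
split=> [pal|[[j /andP [_ j2] wE]|[k /andP [k1 kn] wE]]].
- have xn := size_pt w; have n1 : 1 < size (pt w) by rewrite xn.
  have row j : j <= n.*2 -> pt w = seg_pt n j ->
      exists2 j : nat, 0 <= j <= n.*2 & seg_part w = one_row j.
    by move=> j2 /(seg_part_one_row hn hw j2) E; exists j.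
  have [B|O|/(abs_sum_seg_pt hn xn) [j /andP [_ j2] E]|[k /andP [k0 kn] E]] :=
    special_or_branching n1.
  + by case: (branching_not_palindromic hn hw B).
  + by left; apply: (row 0) => //; rewrite O xn.
  + by left; apply: row E.
  rewrite xn in kn E; have [k1|k1] := ltnP 1 k.
    right; exists k; first by rewrite k1.
    exact/(seg_part_staircase hn hw kn).
  (* The staircase with [k = 1] is the one-row shape (1), which the second alternative leaves
     out. *)
  left; apply: (row 1%N); first by lia.
  by rewrite seg_pt1 // E (_ : k = 1%N) //; lia.
- have /(seg_part_one_row hn hw j2) E := wE.
  have -> : w = segment n j.
    apply: (minreps_inj hn hw (segment_minreps hn j2)).
    by have [-> _] := seg_ptP hn j2.
  exact: palindromic_segment.
have /(seg_part_staircase hn hw kn) E := wE.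
have -> : w = stair n k.
  by apply: (minreps_inj hn hw (stair_minreps hn kn)); rewrite pt_stair.
exact: palindromic_stair.
Qed.
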